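(* Let $K$ be a commutative ring, let $Q$ and $Q'$ be two finite quivers on the same set of vertices $Q_0$, let $(Q,(\rho_\alpha)_{\alpha\in Q_1})$ and $(Q',(\rho'_\beta)_{\beta\in Q'_1})$ be hyperpotentials and let $\Gamma=\Gamma(Q,(\rho_\alpha))$, $\Gamma'=\Gamma(Q',(\rho'_\beta))$ be the corresponding Ginzburg dg-algebras. (a) $(Q,(\rho_\alpha))$ and $(Q',(\rho'_\beta))$ are right equivalent if and only if there exists a continuous isomorphism of dg-algebras $\Phi\colon\Gamma\to\Gamma'$ such that $\Phi(e_i)=e'_i$ and $\Phi(t_i)=t'_i$ for all $i\in Q_0$. (b) $(Q,(\rho_\alpha))$ and $(Q',(\rho'_\beta))$ are weakly right equivalent if and only if there exist a continuous isomorphism of dg-algebras $\Phi\colon\Gamma\to\Gamma'$ and an element $c\in K^\times$ such that $\Phi(e_i)=e'_i$ and $\Phi(t_i)=c\,t'_i$ for all $i\in Q_0$.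
   Context: For a finite quiver $Q$ with vertices $Q_0$ and arrows $Q_1$, paths are composed from left to right; for an arrow $\alpha\colon i\to j$ put $s(\alpha)=i$, $t(\alpha)=j$. $A=\widehat{KQ}$ is the completed path algebra (possibly infinite $K$-linear combinations of paths), $e_i$ is the trivial path at $i$, so $\alpha\in e_{s(\alpha)}Ae_{t(\alpha)}$. For $Q'$ write $A'=\widehat{KQ'}$, with idempotents $e'_i$. $\widehat\otimes$ is the completed tensor product over $K$. Hyperpotential on $Q$: a collection $(\rho_\alpha)_{\alpha\in Q_1}$ with $\rho_\alpha\in e_{t(\alpha)}Ae_{s(\alpha)}$ and $\sum_{\alpha\in Q_1}[\alpha,\rho_\alpha]=0$ in $A$. Ginzburg dg-algebra $\Gamma(Q,(\rho_\alpha))$: let $\widetilde Q$ be the graded quiver with vertex set $Q_0$ and arrows the arrows of $Q$ (degree $0$), an arrow $\alpha^*\colon j\to i$ of degree $-1$ for each $\alpha\colon i\to j$ in $Q_1$, and a loop $t_i$ of degree $-2$ at each $i\in Q_0$. As a graded algebra it is the completion of $K\widetilde Q$ with respect to path length (each graded piece consists of the infinite linear combinations of paths of the given degree). The differential is the continuous $K$-linear map of degree $1$ satisfying the graded Leibniz rule with $d(\alpha)=0$, $d(\alpha^* )=\rho_\alpha$, $d(t_i)=e_i\bigl(\sum_{\beta\in Q_1}[\beta,\beta^*]\bigr)e_i$ (and $d(e_i)=0$). The loops of degree $-2$ in $\Gamma'$ are denoted $t'_i$. Action of homomorphisms on hyperpotentials: for $\beta\in Q'_1$, let $\Delta_\beta\colon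 A'\to A'\widehat\otimes A'$ be the continuous linear map with $\Delta_\beta(e'_i)=0$ and $\Delta_\beta(\beta_1\cdots\beta_n)=\sum_{j:\beta_j=\beta}\beta_1\cdots\beta_{j-1}\otimes\beta_{j+1}\cdots\beta_n$ on paths (empty products are the appropriate trivial paths); and let $(a\otimes b)\diamond x=bxa$, extended linearly and continuously. For a continuous algebra homomorphism $\varphi\colon A\to A'$ with $\varphi(e_i)=e'_i$ for all $i$, and a hyperpotential $(\rho_\alpha)$ on $Q$, $\varphi_*((\rho_\alpha)_{\alpha\in Q_1})$ is the hyperpotential on $Q'$ whose component at $\beta\in Q'_1$ is $\sum_{\alpha\in Q_1}\Delta_\beta(\varphi(\alpha))\diamond\varphi(\rho_\alpha)$. (This is the map induced by $\varphi$ on first continuous Hochschild homology, under the identification of hyperpotentials with elements of $\mathrm{HH}_1$.) $(Q,(\rho_\alpha))$ and $(Q',(\rho'_\beta))$ are right equivalent if there is a continuous isomorphism of algebras $\varphi\colon A\to A'$ with $\varphi(e_i)=e'_i$ for all $i\in Q_0$ and $\varphi_*((\rho_\alpha))=(\rho'_\beta)$. They are weakly right equivalent if there is $c\in K^\times$ such that $(Q,(c\rho_\alpha))$ and $(Q',(\rho'_\beta))$ are right equivalent. *)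

(* Defs.v *)
From HB Require Import structures.
From mathcomp Require Import all_boot all_order all_algebra.
From mathcomp Require Import all_classical.
From mathcomp Require Import topology.

Set Implicit Arguments.
Unset Strict Implicit.
Unset Printing Implicit Defensive.

Import Order.TTheory GRing.Theory Num.Theory.

Local Open Scope classical_set_scope.
Local Open Scope ring_scope.

Record quiver (V : finType) := Quiver {
  arrow : finType;
  src : arrow -> V;
  tgt : arrow -> V
}.

Section Paths.
Variables (V : finType) (Q : quiver V).
Implicit Types (i : V) (w : seq (arrow Q)).

Fixpoint is_path i w : bool :=
  if w is a :: w' then (src a == i) && is_path (tgt a) w' else true.

Definition endpoint i w : V := last i [seq tgt a | a <- w].

(* A path is a starting vertex together with a composable word of arrows,
   composed from left to right; the trivial path at [i] is [(i, [::])]. *)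
Record qpath := QPath {
  pval : V * seq (arrow Q);
  qpathP : is_path pval.1 pval.2
}.

HB.instance Definition _ := [isSub for pval].
HB.instance Definition _ := [Countable of qpath by <:].

Implicit Types p q u v : qpath.

Definition psrc p : V := (pval p).1.
Definition pword p : seq (arrow Q) := (pval p).2.
Definition ptgt p : V := endpoint (psrc p) (pword p).
Definition plen p : nat := size (pword p).

Lemma is_path_cat i w1 w2 :
  is_path i (w1 ++ w2) = is_path i w1 && is_path (endpoint i w1) w2.
Proof. by elim: w1 i => //= a w1 IH i; rewrite IH andbA. Qed.

Lemma qpathE p q : psrc p = psrc q -> pword p = pword q -> p = q.
Proof.
case: p q => [[i w] ?] [[j z] ?] ij wz; apply: val_inj.
by rewrite /psrc /pword /= in ij wz *; rewrite ij wz.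
Qed.

Definition ptriv i : qpath := @QPath (i, [::]) isT.

Lemma parrow_subproof (a : arrow Q) : is_path (src a) [:: a].
Proof. by rewrite /= eqxx. Qed.

Definition parrow (a : arrow Q) : qpath :=
  @QPath (src a, [:: a]) (parrow_subproof a).

Lemma ptake_subproof k p : is_path (psrc p) (take k (pword p)).
Proof.
have := qpathP p; rewrite -/(psrc p) -/(pword p) -{1}(cat_take_drop k (pword p)).
by rewrite is_path_cat => /andP[].
Qed.

Lemma pdrop_subproof k p :
  is_path (endpoint (psrc p) (take k (pword p))) (drop k (pword p)).
Proof.
have := qpathP p; rewrite -/(psrc p) -/(pword p) -{1}(cat_take_drop k (pword p)).
by rewrite is_path_cat => /andP[].
Qed.

Definition ptake k p : qpath :=
  @QPath (psrc p, take k (pword p)) (ptake_subproof k p).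

Definition pdrop k p : qpath :=
  @QPath (endpoint (psrc p) (take k (pword p)), drop k (pword p))
         (pdrop_subproof k p).

End Paths.

Section FactorizationSums.
Variables (V : finType) (Q : quiver V) (R : nmodType).
Implicit Types p q : qpath Q.

(* [psum p F] is the sum of [F u v] over the factorizations [p = uv]. *)
Definition psum p (F : qpath Q -> qpath Q -> R) : R :=
  \sum_(k < (plen p).+1) F (ptake k p) (pdrop k p).

Lemma eq_psum p F G : (forall u v, F u v = G u v) -> psum p F = psum p G.
Proof. by move=> FG; apply: eq_bigr => k _. Qed.

Lemma psumD p F G :
  psum p (fun u v => F u v + G u v) = psum p F + psum p G.
Proof. exact: big_split. Qed.

Lemma psum_sum (I : finType) p (F : I -> qpath Q -> qpath Q -> R) :
  psum p (fun u v => \sum_i F i u v) = \sum_i psum p (F i).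
Proof. exact: exchange_big. Qed.

Lemma plen_take k p : (k <= plen p)%N -> plen (ptake k p) = k.
Proof. by move=> kp; rewrite /plen /ptake /pword /= size_take_min; apply/minn_idPl. Qed.

Lemma plen_drop k p : plen (pdrop k p) = (plen p - k)%N.
Proof. by rewrite /plen /pdrop /pword /= size_drop. Qed.

Lemma sum_triangle n (H : nat -> nat -> R) :
  \sum_(l < n.+1) \sum_(k < l.+1) H k (l - k)%N
  = \sum_(k < n.+1) \sum_(j < (n - k).+1) H k j.
Proof.
elim: n H => [|n IH] H; first by rewrite !big_ord1.
rewrite big_ord_recl big_ord1 [RHS]big_ord_recl /= !subn0.
rewrite [X in _ = X + _]big_ord_recl -[RHS]addrA.
congr (_ + _); rewrite -(IH (fun k j => H k.+1 j)) -big_split.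
by apply: eq_bigr => l _; rewrite big_ord_recl.
Qed.

Lemma psumA p (G : qpath Q -> qpath Q -> qpath Q -> R) :
  psum p (fun q w => psum q (fun u v => G u v w))
  = psum p (fun u q => psum q (fun v w => G u v w)).
Proof.
rewrite /psum.
transitivity (\sum_(l < (plen p).+1) \sum_(k < l.+1)
    G (ptake k (ptake l p)) (pdrop k (ptake l p)) (pdrop l p)).
  by apply: eq_bigr => l _; rewrite plen_take // -ltnS.
under [RHS]eq_bigr => k _ do rewrite plen_drop.
rewrite -(sum_triangle (plen p) (fun k j =>
   G (ptake k p) (ptake j (pdrop k p)) (pdrop j (pdrop k p)))).
apply: eq_bigr => l _; apply: eq_bigr => k _.
have kl : (k <= l)%N by rewrite -ltnS.
congr G; apply: val_inj; rewrite /= /psrc /pword /=.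
- by rewrite take_takel.
- by rewrite take_takel // take_drop subnK.
rewrite drop_drop subnK //; congr pair.
rewrite take_drop subnK // -(take_takel _ kl) /endpoint -last_cat -map_cat.
by rewrite cat_take_drop.
Qed.

End FactorizationSums.

(* The completed path algebra: families of coefficients indexed by the paths,
   i.e. possibly infinite linear combinations of paths. *)
Record pathalg (K : comPzRingType) (V : finType) (Q : quiver V) :=
  PathAlg { coef :> qpath Q -> K }.

Arguments pathalg K {V} Q.
Arguments PathAlg {K V Q} coef.

Section PathAlgebra.
Variables (K : comPzRingType) (V : finType) (Q : quiver V).
Local Notation A := (pathalg K Q).
Implicit Types (x y z : A) (p q : qpath Q).

Lemma pathalgP x y : (forall p, x p = y p) -> x = y.
Proof. by case: x y => [x] [y] /= /funext ->. Qed.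

HB.instance Definition _ := gen_eqMixin A.
HB.instance Definition _ := gen_choiceMixin A.

Let pzero : A := PathAlg (fun _ => 0).
Let popp x : A := PathAlg (fun p => - x p).
Let padd x y : A := PathAlg (fun p => x p + y p).

Fact paddA : associative padd.
Proof. by move=> x y z; apply: pathalgP => p; apply: addrA. Qed.
Fact paddC : commutative padd.
Proof. by move=> x y; apply: pathalgP => p; apply: addrC. Qed.
Fact padd0 : left_id pzero padd.
Proof. by move=> x; apply: pathalgP => p; apply: add0r. Qed.
Fact paddN : left_inverse pzero popp padd.
Proof. by move=> x; apply: pathalgP => p; apply: addNr. Qed.

HB.instance Definition _ := GRing.isZmodule.Build A paddA paddC padd0 paddN.

Lemma coef0 p : (0 : A) p = 0. Proof. by []. Qed.
Lemma coefD x y p : (x + y) p = x p + y p. Proof. by []. Qed.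
Lemma coefN x p : (- x) p = - x p. Proof. by []. Qed.

Lemma coef_sum (I : Type) (r : seq I) (P : pred I) (F : I -> A) p :
  (\sum_(i <- r | P i) F i) p = \sum_(i <- r | P i) F i p.
Proof. by elim/big_rec2: _ => // i y1 y2 _ <-. Qed.

Let pscale (c : K) x : A := PathAlg (fun p => c * x p).

Fact pscaleA a b x : pscale a (pscale b x) = pscale (a * b) x.
Proof. by apply: pathalgP => p; apply: mulrA. Qed.
Fact pscale1 : left_id 1 pscale.
Proof. by move=> x; apply: pathalgP => p; apply: mul1r. Qed.
Fact pscaleDr : right_distributive pscale +%R.
Proof. by move=> c x y; apply: pathalgP => p; apply: mulrDr. Qed.
Fact pscaleDl x : {morph pscale^~ x : a b / a + b}.
Proof. by move=> a b; apply: pathalgP => p; apply: mulrDl. Qed.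

HB.instance Definition _ :=
  GRing.Zmodule_isLmodule.Build K A pscaleA pscale1 pscaleDr pscaleDl.

Lemma coefZ c x p : (c *: x) p = c * x p. Proof. by []. Qed.

Let pone : A := PathAlg (fun p => (plen p == 0%N)%:R).
Let pmul x y : A := PathAlg (fun p => psum p (fun u v => x u * y v)).

Lemma psumZl c p (F : qpath Q -> qpath Q -> K) :
  c * psum p F = psum p (fun u v => c * F u v).
Proof. exact: mulr_sumr. Qed.

Lemma psumZr c p (F : qpath Q -> qpath Q -> K) :
  psum p F * c = psum p (fun u v => F u v * c).
Proof. exact: mulr_suml. Qed.

Lemma ptake0 p : plen (ptake 0%N p) = 0%N.
Proof. by rewrite /plen /ptake /pword /= take0. Qed.

Lemma pdrop0 p : pdrop 0%N p = p.
Proof.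
by apply: val_inj; rewrite /= take0 drop0 /psrc /pword /endpoint; case: (pval p).
Qed.

Lemma ptake_plen p : ptake (plen p) p = p.
Proof.
by apply: val_inj; rewrite /= take_size /psrc /pword; case: (pval p).
Qed.

Fact pmulA : associative pmul.
Proof.
move=> x y z; apply: pathalgP => p /=.
under [RHS]eq_psum do rewrite psumZr.
under eq_psum do rewrite psumZl.
rewrite psumA; apply: eq_psum => u q; apply: eq_psum => v w.
exact: mulrA.
Qed.

Fact pmul1l : left_id pone pmul.
Proof.
move=> x; apply: pathalgP => p /=; rewrite /psum big_ord_recl /=.
rewrite ptake0 eqxx mul1r pdrop0 big1 ?addr0 // => k _.
by rewrite plen_take ?lift0 ?mul0r // ltn_ord.
Qed.

Fact pmul1r : right_id pone pmul.
Proof.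
move=> x; apply: pathalgP => p /=; rewrite /psum big_ord_recr /=.
rewrite plen_drop subnn eqxx mulr1 ptake_plen big1 ?add0r // => k _.
by rewrite plen_drop subn_eq0 leqNgt ltn_ord mulr0.
Qed.

Fact pmulDl : left_distributive pmul +%R.
Proof.
move=> x y z; apply: pathalgP => p; rewrite coefD /= -psumD.
by apply: eq_psum => u v; apply: mulrDl.
Qed.

Fact pmulDr : right_distributive pmul +%R.
Proof.
move=> x y z; apply: pathalgP => p; rewrite coefD /= -psumD.
by apply: eq_psum => u v; apply: mulrDr.
Qed.

HB.instance Definition _ :=
  GRing.Zmodule_isPzRing.Build A pmulA pmul1l pmul1r pmulDl pmulDr.

Lemma coef1 p : (1 : A) p = (plen p == 0%N)%:R. Proof. by []. Qed.

Lemma coefM x y p : (x * y) p = psum p (fun u v => x u * y v).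
Proof. by []. Qed.

(* The topology of the path-length filtration, [K] being discrete. *)
Definition pathalg_nbhs x : set_system A :=
  filter_from [set: nat]
    (fun n => [set y : A | forall p, (plen p < n)%N -> y p = x p]).

HB.instance Definition _ := hasNbhs.Build A pathalg_nbhs.

Fact pathalg_nbhs_filter x : ProperFilter (nbhs x).
Proof.
apply: filter_from_proper => [|n _]; last by exists x.
apply: filter_from_filter => [|m n _ _]; first by exists 0%N.
by exists (maxn m n) => // y yx; split=> p pn; apply: yx;
  rewrite (leq_trans pn) // ?leq_maxl ?leq_maxr.
Qed.

Fact pathalg_nbhs_singleton x (B : set A) : nbhs x B -> B x.
Proof. by case=> n _; apply. Qed.

Fact pathalg_nbhs_nbhs x (B : set A) : nbhs x B -> nbhs x (nbhs^~ B).
Proof.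
case=> n _ nB; exists n => // y yx; exists n => // z zy.
by apply: nB => p pn; rewrite zy // yx.
Qed.

HB.instance Definition _ := Nbhs_isNbhsTopological.Build A
  pathalg_nbhs_filter pathalg_nbhs_singleton pathalg_nbhs_nbhs.

Definition pbasis p : A := PathAlg (fun q => (q == p)%:R).

Definition idem (i : V) : A := pbasis (ptriv Q i).

Definition arr (a : arrow Q) : A := pbasis (parrow a).

End PathAlgebra.

Arguments idem K {V} Q i.

(* The completed tensor square of the completed path algebra: families of
   coefficients indexed by pairs of paths. *)
Definition ptensor (K : comPzRingType) (V : finType) (Q : quiver V) :=
  qpath Q -> qpath Q -> K.

Section DoubleDerivations.
Variables (K : comPzRingType) (V : finType) (Q : quiver V).
Local Notation A := (pathalg K Q).
Local Notation T := (ptensor K Q).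
Implicit Types (x y z : A) (p q u v w : qpath Q) (b : arrow Q) (S : T).

(* The continuous linear extension of [(u (x) w) -> u x w]. *)
Definition sandwich S x : A :=
  PathAlg (fun p => psum p (fun q w => psum q (fun u v => S u w * x v))).

(* The continuous linear extension of [(u (x) w) -> w x u]. *)
Definition diamond S x : A := sandwich (fun w u => S u w) x.

(* The coefficient of [u (x) w] in [Delta b x] is the coefficient in [x] of the
   path [u b w], and zero when these are not composable. *)
Definition Delta b x : T := fun u w =>
  if (ptgt u == src b) && (tgt b == psrc w)
  then oapp (coef x) 0 (insub (psrc u, pword u ++ b :: pword w))
  else 0.

Lemma sandwich_tens x y z : sandwich (fun u w => x u * y w) z = x * z * y.
Proof.
apply: pathalgP => p; rewrite coefM; apply: eq_psum => q w.
by rewrite coefM psumZr; apply: eq_psum => u v; rewrite mulrAC.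
Qed.

Lemma diamond_tens x y z : diamond (fun u w => x u * y w) z = y * z * x.
Proof.
rewrite -sandwich_tens /diamond; congr sandwich.
by apply/funext => u; apply/funext => w; rewrite mulrC.
Qed.

Lemma DeltaE b x u w q : ptgt u = src b -> tgt b = psrc w ->
  pval q = (psrc u, pword u ++ b :: pword w) -> Delta b x u w = x q.
Proof. by move=> ub bw qE; rewrite /Delta ub bw !eqxx -qE valK. Qed.

Lemma Delta0 b x u w :
  ~~ ((ptgt u == src b) && (tgt b == psrc w)) -> Delta b x u w = 0.
Proof. by rewrite /Delta => /negbTE->. Qed.

Lemma DeltaD b x y u w : Delta b (x + y) u w = Delta b x u w + Delta b y u w.
Proof.
by rewrite /Delta; case: ifP; [case: insub => [q|] /= _|]; rewrite ?addr0.
Qed.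

Lemma DeltaZ b c x u w : Delta b (c *: x) u w = c * Delta b x u w.
Proof.
by rewrite /Delta; case: ifP; [case: insub => [q|] /= _|]; rewrite ?mulr0.
Qed.

Lemma glue_subproof b u w : ptgt u = src b -> tgt b = psrc w ->
  is_path (psrc u) (pword u ++ b :: pword w).
Proof.
move=> ub bw; rewrite is_path_cat (qpathP u) /= -/(ptgt u) ub eqxx bw.
exact: (qpathP w).
Qed.

Lemma pval_glue b p k : (k < plen p)%N -> nth b (pword p) k = b ->
  [/\ ptgt (ptake k p) = src b, tgt b = psrc (pdrop k.+1 p) &
      pval p = (psrc p, pword (ptake k p) ++ b :: pword (pdrop k.+1 p))].
Proof.
move=> kp nb; have pE : pword p = take k (pword p) ++ b :: drop k.+1 (pword p).
  by rewrite -[X in X :: drop _ _]nb -drop_nth // cat_take_drop.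
have := qpathP p; rewrite -/(psrc p) -/(pword p) {1}pE is_path_cat /=.
case/and3P=> _ /eqP sb _; split=> //.
- rewrite /psrc /= (take_nth b kp) nb /endpoint -cats1 map_cat last_cat //.
- by rewrite -pE /psrc /pword; case: (pval p).
Qed.

(* On a path, [Delta b] is the sum of the [u (x) w] over the occurrences of [b]
   in the path, [u] and [w] being what precedes and follows the occurrence. *)
Lemma Delta_pbasis b p u w :
  Delta b (pbasis K p) u w = \sum_(k < plen p | nth b (pword p) k == b)
    (u == ptake k p)%:R * (w == pdrop k.+1 p)%:R.
Proof.
have [/andP[/eqP ub /eqP bw]|nubw] :=
  boolP ((ptgt u == src b) && (tgt b == psrc w)); last first.
  rewrite Delta0 // big1 // => k /eqP nb.
  have [ub bw _] := pval_glue (ltn_ord k) nb.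
  case: (u =P _) nubw => [->|]; rewrite ?mul0r // ub eqxx /=.
  by case: (w =P _) => [->|]; rewrite ?mulr0 // bw eqxx.
pose q : qpath Q := QPath (glue_subproof ub bw : is_path (_, _).1 (_, _).2).
rewrite (@DeltaE _ _ _ _ q) //=.
have [<-|/eqP nqp] := eqVneq q p.
  have uq : (plen u < plen q)%N.
    by rewrite /plen /pword /= size_cat /= addnS ltnS leq_addr.
  have nq : nth b (pword q) (plen u) = b.
    by rewrite /pword /= nth_cat ltnn subnn.
  rewrite (bigD1 (Ordinal uq)) ?nq ?eqxx //= big1 ?addr0.
    have uE : ptake (plen u) q = u.
      by apply: qpathE; rewrite // /pword /= take_size_cat.
    have wE : pdrop (plen u).+1 q = w.
      have [_ bw' _] := pval_glue uq nq.
      apply: qpathE; first by rewrite -bw'.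
      by rewrite /pword /= drop_cat ltnNge leqnSn /= subSnn /= ?drop0.
    by rewrite uE wE !eqxx mulr1.
  move=> k /andP[_ /eqP ku]; case: eqP => [uE|]; rewrite ?mul0r //.
  case: ku; apply: val_inj; rewrite /= uE plen_take //; exact/ltnW/ltn_ord.
rewrite big1 // => k /eqP nb; case: eqP => [uE|]; rewrite ?mul0r //.
case: eqP => [wE|]; rewrite ?mulr0 //; case: nqp; apply: val_inj => /=.
by have [_ _ ->] := pval_glue (ltn_ord k) nb; rewrite -uE -wE uE.
Qed.

Lemma Delta_idem b i u w : Delta b (idem K Q i) u w = 0.
Proof. by rewrite Delta_pbasis big_ord0. Qed.

Lemma ptgt_drop k p : ptgt (pdrop k p) = ptgt p.
Proof.
by rewrite /ptgt /endpoint /psrc /pword /= -last_cat -map_cat cat_take_drop.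
Qed.

Lemma DeltaM b x y u w : Delta b (x * y) u w =
  psum u (fun u1 u2 => x u1 * Delta b y u2 w)
  + psum w (fun w1 w2 => Delta b x u w1 * y w2).
Proof.
have [/andP[/eqP ub /eqP bw]|nubw] := boolP ((ptgt u == src b) && (tgt b == psrc w)).
  pose q : qpath Q := QPath (glue_subproof ub bw : is_path (_, _).1 (_, _).2).
  rewrite (@DeltaE _ _ _ _ q) // coefM /psum.
  have -> : (plen q).+1 = ((plen u).+1 + (plen w).+1)%N.
    by rewrite /plen /pword /= size_cat /= addnS addSn addnS.
  rewrite big_split_ord /=; congr (_ + _); apply: eq_bigr => k _.
    have ku : (k <= plen u)%N by rewrite -ltnS.
    rewrite -(@DeltaE b y (pdrop k u) w (pdrop k q)) ?ptgt_drop //.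
      congr (x _ * _); apply: val_inj; rewrite /= /psrc /pword /=.
      by rewrite takel_cat.
    by rewrite /= /psrc /pword /= takel_cat // drop_cat ltn_neqAle ku andbT;
      case: eqP => //= ->; rewrite subnn drop0 drop_size.
  rewrite -(@DeltaE b x u (ptake k w) (ptake ((plen u).+1 + k) q)) //; last first.
    by rewrite /= /psrc /pword /= take_cat addSn -addnS ltnNge leq_addr /= addKn.
  congr (_ * y _); apply: val_inj; rewrite /= /psrc /pword /=.
  rewrite take_cat drop_cat addSn -addnS ltnNge leq_addr /= addKn.
  congr pair; rewrite /endpoint map_cat last_cat /=.
  by rewrite bw.
rewrite Delta0 // {1}/psum big1 ?add0r => [|k _].
  rewrite /psum big1 // => k _; rewrite Delta0 ?mul0r //.
by rewrite Delta0 ?mulr0 // ptgt_drop.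
Qed.

End DoubleDerivations.

Section Hyperpotentials.
Variables (K : comPzRingType) (V : finType).
Implicit Types (Q : quiver V).

Definition hyperpotential Q (rho : arrow Q -> pathalg K Q) : Prop :=
  (forall a, idem K Q (tgt a) * rho a * idem K Q (src a) = rho a)
  /\ \sum_a (arr K a * rho a - rho a * arr K a) = 0.

Definition pushforward Q Q' (phi : pathalg K Q -> pathalg K Q')
    (rho : arrow Q -> pathalg K Q) (b : arrow Q') : pathalg K Q' :=
  \sum_a diamond (Delta b (phi (arr K a))) (phi (rho a)).

(* Algebra isomorphisms are spelled out as scalable ring morphisms: the path
   algebra is the zero ring when [V] is empty or [K] is trivial, so it is not
   an [lalgType]. *)
Definition right_equivalent Q Q' (rho : arrow Q -> pathalg K Q)
    (rho' : arrow Q' -> pathalg K Q') : Prop :=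
  exists phi : {rmorphism pathalg K Q -> pathalg K Q'},
    [/\ scalable phi, bijective phi, continuous phi,
        (forall i, phi (idem K Q i) = idem K Q' i)
      & (forall b, pushforward phi rho b = rho' b)].

Definition invertible (c : K) : Prop := exists c' : K, c * c' = 1.

Definition weakly_right_equivalent Q Q' (rho : arrow Q -> pathalg K Q)
    (rho' : arrow Q' -> pathalg K Q') : Prop :=
  exists2 c : K, invertible c & right_equivalent (fun a => c *: rho a) rho'.

End Hyperpotentials.

Section GradedQuiver.
Variables (V : finType) (Q : quiver V).

(* The three summands are the arrows of [Q], their duals and the loops. *)
Definition garrow : finType := (arrow Q + arrow Q + V)%type.

Definition gsrc (g : garrow) : V :=
  match g with inl (inl a) => src a | inl (inr a) => tgt a | inr i => i end.

Definition gtgt (g : garrow) : V :=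
  match g with inl (inl a) => tgt a | inl (inr a) => src a | inr i => i end.

Definition ginzburg_quiver : quiver V := Quiver gsrc gtgt.

Definition gdeg (g : garrow) : int :=
  match g with inl (inl _) => 0 | inl (inr _) => -1 | inr _ => -2 end.

Definition pdeg (p : qpath ginzburg_quiver) : int :=
  \sum_(g <- pword p) gdeg g.

Definition plain (g : garrow) : option (arrow Q) :=
  if g is inl (inl a) then Some a else None.

Definition garr (a : arrow Q) : arrow ginzburg_quiver := inl (inl a).
Definition gdual (a : arrow Q) : arrow ginzburg_quiver := inl (inr a).
Definition gloop (i : V) : arrow ginzburg_quiver := inr i.

Lemma pdeg_take_drop k p : pdeg p = pdeg (ptake k p) + pdeg (pdrop k p).
Proof. by rewrite /pdeg -big_cat /= cat_take_drop. Qed.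

Lemma gpath_subproof (p : qpath Q) :
  @is_path V ginzburg_quiver (psrc p) [seq garr a | a <- pword p].
Proof.
case: p => [[i w]] /=; rewrite /psrc /pword /=.
by elim: w i => //= a w IH i /andP[-> /IH].
Qed.

Definition gpath (p : qpath Q) : qpath ginzburg_quiver :=
  @QPath V ginzburg_quiver (psrc p, [seq garr a | a <- pword p])
    (gpath_subproof p).

End GradedQuiver.

Section GinzburgAlgebra.
Variables (K : comPzRingType) (V : finType) (Q : quiver V).
Local Notation Qt := (ginzburg_quiver Q).
Local Notation At := (pathalg K Qt).
Implicit Types (x y z : At) (p q u v w : qpath Qt) (b : arrow Qt).

(* The inclusion of the completed path algebra of [Q]. *)
Definition gincl (x : pathalg K Q) : At := PathAlg (fun p =>
  if all (fun g => isSome (plain g)) (pword p)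
  then oapp (coef x) 0 (insub (psrc p, pmap (@plain V Q) (pword p))) else 0).

Lemma gincl_gpath (x : pathalg K Q) (r : qpath Q) : gincl x (gpath r) = x r.
Proof.
have wE : pword (gpath r) = map (@garr V Q) (pword r) by [].
rewrite /gincl /= wE all_map (eq_all (a2 := predT)) // all_predT map_pK //.
rewrite -[X in insub X]/(psrc r, pword r).
by have -> : (psrc r, pword r) = val r; [case: (r) => [[]]|rewrite valK].
Qed.

Lemma plain_gpath q : all (fun g => isSome (plain g)) (pword q) ->
  exists r : qpath Q, q = gpath r.
Proof.
move=> plq; pose w := pmap (@plain V Q) (pword q).
have wE : pword q = map (@garr V Q) w.
  by rewrite /w; elim: (pword q) plq => //= -[[a|a]|i] s IH //= /IH <-.
have rP : @is_path V Q (psrc q) w.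
  have := qpathP q; rewrite -/(psrc q) -/(pword q) wE.
  by elim: w (psrc q) {wE} => //= a w IH i /andP[-> /IH].
by exists (@QPath V Q (psrc q, w) rP); apply: qpathE.
Qed.

Lemma gincl_out (x : pathalg K Q) q :
  ~~ all (fun g => isSome (plain g)) (pword q) -> gincl x q = 0.
Proof. by rewrite /gincl /= => /negbTE->. Qed.

Lemma ginclM : {morph gincl : x y / x * y}.
Proof.
move=> x y; apply: pathalgP => q.
have [/plain_gpath[r ->]|npl] :=
  boolP (all (fun g => isSome (plain g)) (pword q)).
  rewrite gincl_gpath !coefM /psum.
  have -> : plen (gpath r) = plen r by rewrite /plen /pword /= size_map.
  apply: eq_bigr => k _; rewrite -!gincl_gpath.
  congr (gincl x _ * gincl y _); apply: qpathE.
  - by [].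
  - by rewrite /pword /= map_take.
  - rewrite /psrc /pword /= -map_take /endpoint -map_comp.
    by congr last; apply: eq_map.
  - by rewrite /pword /= map_drop.
rewrite gincl_out // coefM /psum big1 // => k _.
move: npl; rewrite -(cat_take_drop k (pword q)) all_cat negb_and.
by case/orP=> npl; [rewrite gincl_out ?mul0r|rewrite [X in _ * X]gincl_out ?mulr0].
Qed.

Lemma gincl_idem i : gincl (idem K Q i) = idem K Qt i.
Proof.
apply: pathalgP => q; have [/plain_gpath[r ->]|npl] :=
  boolP (all (fun g => isSome (plain g)) (pword q)).
  rewrite gincl_gpath /=; congr (nat_of_bool _)%:R.
  apply/eqP/eqP => [->|ri]; first exact: qpathE.
  apply: qpathE; first by rewrite -[LHS]/(psrc (gpath r)) ri.
  apply/size0nil; rewrite -(size_map (@garr V Q)).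
  by rewrite -[map _ _]/(pword (gpath r)) ri.
rewrite gincl_out //=; case: eqP npl => // ->; rewrite //.
Qed.

Definition gsum_commutators : At :=
  \sum_(a : arrow Q) (arr K (garr a) * arr K (gdual a)
                      - arr K (gdual a) * arr K (garr a)).

Definition gdiff_arrow (rho : arrow Q -> pathalg K Q) (b : arrow Qt) : At :=
  match b with
  | inl (inl a) => 0
  | inl (inr a) => gincl (rho a)
  | inr i => idem K Qt i * gsum_commutators * idem K Qt i
  end.

Definition gsign x : At := PathAlg (fun p => (-1) ^+ `|pdeg p|%N * x p).

(* The continuous linear map sending a path [p] to the sum of
   [(-1) ^ |u| u (d b) w] over the occurrences [p = u b w] of arrows in [p]. *)
Definition gdiff (rho : arrow Q -> pathalg K Q) x : At :=
  \sum_b sandwich (fun u w => (-1) ^+ `|pdeg u|%N * Delta b x u w)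
                  (gdiff_arrow rho b).

End GinzburgAlgebra.

Section Degrees.
Variables (K : comPzRingType) (V : finType) (Q : quiver V).
Local Notation Qt := (ginzburg_quiver Q).
Local Notation At := (pathalg K Qt).
Implicit Types (x y z : At) (p q u v w : qpath Qt) (b : arrow Qt).
Implicit Types (D E : set int) (m n : int) (rho : arrow Q -> pathalg K Q).

(* The degrees of the paths occurring in [x] lie in [D]. *)
Definition degrees_in D x : Prop := forall p, ~ D (pdeg p) -> x p = 0.

Lemma degrees_inW D E x : D `<=` E -> degrees_in D x -> degrees_in E x.
Proof. by move=> DE xD p np; apply: xD => /DE. Qed.

Lemma degrees_in0 D : degrees_in D 0.
Proof. by []. Qed.

Lemma degrees_inD D x y :
  degrees_in D x -> degrees_in D y -> degrees_in D (x + y).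
Proof. by move=> xD yD p np; rewrite coefD xD // yD // addr0. Qed.

Lemma degrees_inN D x : degrees_in D x -> degrees_in D (- x).
Proof. by move=> xD p np; rewrite coefN xD // oppr0. Qed.

Lemma degrees_inZ D c x : degrees_in D x -> degrees_in D (c *: x).
Proof. by move=> xD p np; rewrite coefZ xD // mulr0. Qed.

Lemma degrees_in_sum D (I : finType) (F : I -> At) :
  (forall i, degrees_in D (F i)) -> degrees_in D (\sum_i F i).
Proof. by move=> FD p np; rewrite coef_sum big1 // => i _; apply: FD. Qed.

Lemma degrees_inM D E x y : degrees_in D x -> degrees_in E y ->
  degrees_in [set m + n | m in D & n in E] (x * y).
Proof.
move=> xD yE p np; rewrite coefM /psum big1 // => k _.
have [Dk|nDk] := pselect (D (pdeg (ptake k p))); last by rewrite xD ?mul0r.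
rewrite yE ?mulr0 // => Ek; apply: np; exists (pdeg (ptake k p)) => //.
by exists (pdeg (pdrop k p)) => //; rewrite -pdeg_take_drop.
Qed.

Lemma degrees_in_pbasis p : degrees_in [set pdeg p] (pbasis K p).
Proof. by move=> q /= nqp; case: eqP => // qp; case: nqp; rewrite /= qp. Qed.

Lemma pdeg_triv i : pdeg (ptriv Qt i) = 0.
Proof. exact: big_nil. Qed.

Lemma pdeg_arrow b : pdeg (parrow b) = gdeg b.
Proof. exact: big_seq1. Qed.

Lemma degrees_in_arr b : degrees_in [set gdeg b] (arr K b).
Proof. by rewrite -pdeg_arrow; apply: degrees_in_pbasis. Qed.

Lemma degrees_in_idem i : degrees_in [set 0] (idem K Qt i).
Proof. by rewrite -(pdeg_triv i); apply: degrees_in_pbasis. Qed.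

Lemma degrees_in_gincl (x : pathalg K Q) : degrees_in [set 0] (gincl x).
Proof.
move=> p np; apply/gincl_out/negP => /plain_gpath[r pr]; apply: np.
by rewrite /= pr /pdeg /pword /= big_map big1.
Qed.

Lemma degrees_inM1 m n x y : degrees_in [set m] x -> degrees_in [set n] y ->
  degrees_in [set m + n] (x * y).
Proof.
move=> xm yn; apply: degrees_inW (degrees_inM xm yn).
by move=> _ [_ -> [_ -> <-]].
Qed.

Lemma degrees_in_gdiff_arrow rho b :
  degrees_in [set gdeg b + 1] (gdiff_arrow rho b).
Proof.
case: b => [[a|a]|i] /=; first exact: degrees_in0.
  exact: degrees_in_gincl.
have -> : -2 + 1 = 0 + -1 + 0 :> int by [].
apply: degrees_inM1; last exact: degrees_in_idem.
apply: degrees_inM1; first exact: degrees_in_idem.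
apply: degrees_in_sum => a; apply: degrees_inD.
  exact: (degrees_inM1 (@degrees_in_arr (garr a)) (@degrees_in_arr (gdual a))).
apply: degrees_inN.
exact: (degrees_inM1 (@degrees_in_arr (gdual a)) (@degrees_in_arr (garr a))).
Qed.

Lemma degrees_in_gdiff D rho x :
  degrees_in D x -> degrees_in [set n | D (n - 1)] (gdiff rho x).
Proof.
move=> xD p np; rewrite coef_sum big1 // => b _ /=.
rewrite /psum big1 // => l _; rewrite big1 // => k _.
set q := ptake l p; set u := ptake k q; set v := pdrop k q; set w := pdrop l p.
have [vb|nvb] := pselect (pdeg v = gdeg b + 1); last first.
  by rewrite [X in _ * X]degrees_in_gdiff_arrow ?mulr0.
have [/andP[/eqP ub /eqP bw]|nubw] :=
  boolP ((ptgt u == src b) && (tgt b == psrc w)); last by rewrite Delta0 ?mulr0 ?mul0r.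
pose r : qpath Qt := QPath (glue_subproof ub bw : is_path (_, _).1 (_, _).2).
rewrite (@DeltaE _ _ _ _ _ _ _ r) // xD ?mulr0 ?mul0r // => Dr; apply: np => /=.
suff -> : pdeg p - 1 = pdeg r by [].
rewrite (pdeg_take_drop l p) -/q -/w (pdeg_take_drop k q) -/u -/v vb.
have -> : pdeg r = pdeg u + (gdeg b + pdeg w).
  by rewrite [pdeg r]/pdeg big_cat big_cons.
by rewrite addrAC -(addrA (pdeg u)) addrK -addrA.
Qed.

Lemma sgnzD m n :
  (-1) ^+ `|(m + n)%R|%N = (-1) ^+ `|m|%N * (-1) ^+ `|n|%N :> K.
Proof.
rewrite -(signr_odd _ `|(m + n)%R|%N) -(signr_odd _ `|m|%N) -(signr_odd _ `|n|%N).
rewrite -signr_addb; congr ((-1) ^+ (nat_of_bool _)).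
apply: (@signr_inj int); rewrite signr_addb !signr_odd.
rewrite -(expN1r _ (m + n)) -(expN1r _ m) -(expN1r _ n).
by rewrite exprzDr // unitrN1.
Qed.

Lemma sandwichMl S x z :
  sandwich (fun u w => psum u (fun u1 u2 => x u1 * S u2 w)) z
  = x * sandwich S z :> At.
Proof.
apply: pathalgP => p; rewrite coefM /=.
transitivity (psum p (fun q w => psum q (fun u r => x u * psum r (fun u2 v =>
    S u2 w * z v)))).
  apply: eq_psum => q w; under eq_psum do rewrite psumZr.
  rewrite psumA; apply: eq_psum => u r; rewrite psumZl.
  by apply: eq_psum => u2 v; rewrite mulrA.
rewrite psumA; apply: eq_psum => u q; rewrite psumZl.
by apply: eq_psum.
Qed.

Lemma sandwichMr S y z :
  sandwich (fun u w => psum w (fun w1 w2 => S u w1 * y w2)) z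
  = sandwich S z * y :> At.
Proof.
apply: pathalgP => p; rewrite coefM /=.
transitivity (psum p (fun q w => psum w (fun w1 w2 =>
    psum q (fun u v => S u w1 * z v) * y w2))).
  apply: eq_psum => q w; under eq_psum do rewrite psumZr.
  transitivity (psum w (fun w1 w2 => psum q (fun u v => S u w1 * y w2 * z v))).
    exact: exchange_big.
  apply: eq_psum => w1 w2; rewrite psumZr.
  by apply: eq_psum => u v; rewrite mulrAC.
rewrite -psumA; apply: eq_psum => q w; rewrite psumZr.
by apply: eq_psum.
Qed.

Lemma sandwichD (S T : ptensor K Qt) z :
  sandwich (fun u w => S u w + T u w) z = sandwich S z + sandwich T z.
Proof.
apply: pathalgP => p; rewrite coefD /= -psumD; apply: eq_psum => q w.
by rewrite -psumD; apply: eq_psum => u v; rewrite mulrDl.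
Qed.

Lemma eq_sandwich (S T : ptensor K Qt) z :
  (forall u w, S u w = T u w) -> sandwich S z = sandwich T z.
Proof.
by move=> ST; apply: pathalgP => p; apply: eq_psum => q w; apply: eq_psum => u v;
  rewrite ST.
Qed.

Lemma gdiffD rho : {morph gdiff rho : x y / x + y}.
Proof.
move=> x y; rewrite /gdiff -big_split /=; apply: eq_bigr => b _.
by rewrite -sandwichD; apply: eq_sandwich => u w; rewrite DeltaD mulrDr.
Qed.

Lemma gdiffZ rho c : {morph gdiff rho : x / c *: x}.
Proof.
move=> x; rewrite /gdiff scaler_sumr; apply: eq_bigr => b _.
apply: pathalgP => p; rewrite coefZ /= psumZl; apply: eq_psum => q w.
by rewrite psumZl; apply: eq_psum => u v; rewrite DeltaZ mulrCA !mulrA.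
Qed.

Lemma gdiffM rho x y :
  gdiff rho (x * y) = gdiff rho x * y + gsign x * gdiff rho y.
Proof.
rewrite /gdiff mulr_suml mulr_sumr -big_split /=; apply: eq_bigr => b _.
rewrite addrC -[X in X + _]sandwichMl.
rewrite -[X in _ + X]sandwichMr -sandwichD; apply: eq_sandwich => u w.
rewrite DeltaM mulrDr psumZl psumZl; congr (_ + _).
  rewrite /psum; apply: eq_bigr => k _ /=.
  by rewrite (pdeg_take_drop k u) sgnzD mulrACA.
by apply: eq_psum => w1 w2; rewrite mulrA.
Qed.

Lemma gdiff_idem rho i : gdiff rho (idem K Qt i) = 0.
Proof.
rewrite /gdiff big1 // => b _; apply: pathalgP => p /=.
rewrite /psum big1 // => l _; rewrite big1 // => k _.
by rewrite Delta_idem mulr0 mul0r.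
Qed.

Lemma gdiff_arr rho b : gdiff rho (arr K b)
  = idem K Qt (src b) * gdiff_arrow rho b * idem K Qt (tgt b).
Proof.
have D0 c u w : Delta c (arr K b) u w =
    (b == c)%:R * ((u == ptriv _ (src b))%:R * (w == ptriv _ (tgt b))%:R).
  rewrite Delta_pbasis big_mkcond big_ord1 /=.
  case: (b =P c) => [->|]; last by rewrite mul0r.
  rewrite mul1r.
  by congr ((nat_of_bool (_ == _))%:R * (nat_of_bool (_ == _))%:R); apply: qpathE.
rewrite /gdiff (bigD1 b) //= big1 ?addr0 => [|c cb].
  rewrite -sandwich_tens; apply: eq_sandwich => u w; rewrite D0 eqxx mul1r /=.
  case: (u =P _) => [->|]; last by rewrite !mul0r mulr0.
  by rewrite pdeg_triv mul1r.
apply: pathalgP => p /=; rewrite /psum big1 // => l _; rewrite big1 // => k _.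
by rewrite D0 eq_sym (negbTE cb) mul0r mulr0 mul0r.
Qed.

Lemma idem_idem i : idem K Qt i * idem K Qt i = idem K Qt i.
Proof.
apply: pathalgP => p; rewrite coefM /psum big_ord_recl /= pdrop0.
rewrite big1 ?addr0 => [|k _]; last first.
  case: eqP => [pk|]; last by rewrite mul0r.
  have := congr1 (@plen V Qt) pk; rewrite plen_take ?lift0 // ltn_ord //.
case: (p =P _) => [->|]; last by rewrite mulr0.
by case: eqP => [|[]]; [rewrite mulr1|exact: qpathE].
Qed.

Lemma gdiff_dual rho a :
  idem K Q (tgt a) * rho a * idem K Q (src a) = rho a ->
  gdiff rho (arr K (gdual a)) = gincl (rho a).
Proof. by move=> rhoa; rewrite gdiff_arr /= -!gincl_idem -!ginclM rhoa. Qed.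

Lemma gdiff_loop rho i : gdiff rho (arr K (gloop Q i))
  = idem K Qt i * gsum_commutators K Q * idem K Qt i.
Proof.
rewrite gdiff_arr /= !mulrA idem_idem.
by rewrite -[LHS]mulrA idem_idem.
Qed.

End Degrees.

(* The underlying graded algebra of the Ginzburg dg-algebra, as the direct sum
   of its graded pieces: the degrees being nonpositive, these are the infinite
   linear combinations of paths whose degrees are bounded from below. *)
Definition bounded_degrees (K : comPzRingType) (V : finType) (Q : quiver V) :
    {pred pathalg K (ginzburg_quiver Q)} :=
  [pred x | `[< exists N : int, degrees_in [set n | N <= n] x >]].

Arguments bounded_degrees : clear implicits.

Record ginzburg (K : comPzRingType) (V : finType) (Q : quiver V) := Ginzburg {
  gval : pathalg K (ginzburg_quiver Q);
  gvalP : gval \in bounded_degrees K V Q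
}.

Arguments ginzburg K {V} Q.

Section GinzburgRing.
Variables (K : comPzRingType) (V : finType) (Q : quiver V).
Local Notation Qt := (ginzburg_quiver Q).
Local Notation At := (pathalg K Qt).
Local Notation bounded := (bounded_degrees K V Q).

HB.instance Definition _ := [isSub for (@gval K V Q)].
HB.instance Definition _ := [Choice of ginzburg K Q by <:].

Lemma boundedP (x : At) :
  reflect (exists N : int, degrees_in [set n | N <= n] x) (x \in bounded).
Proof. exact: asboolP. Qed.

Lemma degrees_in1_bounded (n : int) (x : At) :
  degrees_in [set n] x -> x \in bounded.
Proof.
by move=> xn; apply/boundedP; exists n; apply: degrees_inW xn => _ /= ->.
Qed.

Fact bounded_subring : subring_closed bounded.
Proof.
split.
- apply/boundedP; exists 0 => p np; rewrite coef1; case: eqP => // /size0nil p0.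
  by case: np; rewrite /= /pdeg p0 big_nil.
- move=> x y /boundedP[M xM] /boundedP[N yN]; apply/boundedP.
  exists (Num.min M N); apply: degrees_inD.
    by apply: degrees_inW xM => n /= Mn; rewrite ge_min Mn.
  by apply/degrees_inN; apply: degrees_inW yN => n /= Nn; rewrite ge_min Nn orbT.
- move=> x y /boundedP[M xM] /boundedP[N yN]; apply/boundedP; exists (M + N).
  apply: degrees_inW (degrees_inM xM yN) => _ [m Mm] [n Nn <-] /=.
  exact: lerD.
Qed.

Fact bounded_scaler : scaler_closed bounded.
Proof.
by move=> c x /boundedP[M xM]; apply/boundedP; exists M; apply: degrees_inZ.
Qed.

HB.instance Definition _ :=
  GRing.isSubringClosed.Build At (bounded_degrees K V Q) bounded_subring.
HB.instance Definition _ :=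
  GRing.isScaleClosed.Build K At (bounded_degrees K V Q) bounded_scaler.
HB.instance Definition _ := 
  GRing.SubChoice_isSubPzRing.Build At (bounded_degrees K V Q) (ginzburg K Q)
    bounded_subring.
HB.instance Definition _ := [SubZmodule_isSubLmodule of ginzburg K Q by <:].

(* On each graded piece this is the topology of the path-length filtration. *)
HB.instance Definition _ :=
  Topological.copy (ginzburg K Q) (initial_topology (@gval K V Q)).

Definition homogeneous (n : int) : set (ginzburg K Q) :=
  [set x | degrees_in [set n] (gval x)].

Definition gpathelt (p : qpath Qt) : ginzburg K Q :=
  Ginzburg (degrees_in1_bounded (@degrees_in_pbasis K V Q p)).

Definition gidem (i : V) : ginzburg K Q := gpathelt (ptriv Qt i).
Definition tloop (i : V) : ginzburg K Q := gpathelt (parrow (gloop Q i)).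
Definition garrelt (a : arrow Q) : ginzburg K Q := gpathelt (parrow (garr a)).
Definition gdualelt (a : arrow Q) : ginzburg K Q := gpathelt (parrow (gdual a)).

Definition ginclelt (x : pathalg K Q) : ginzburg K Q :=
  Ginzburg (degrees_in1_bounded (degrees_in_gincl x)).

Fact gdiff_bounded rho (x : ginzburg K Q) : gdiff rho (gval x) \in bounded.
Proof.
have /boundedP[N xN] := gvalP x; apply/boundedP; exists (N + 1).
apply: degrees_inW (degrees_in_gdiff rho xN) => n /=.
by rewrite lerBrDr.
Qed.

Definition dginzburg (rho : arrow Q -> pathalg K Q) (x : ginzburg K Q) :
  ginzburg K Q := Ginzburg (gdiff_bounded rho x).

(* The differential is the unique continuous linear map with the properties
   proved in this section. *)
Section Differential.
Variable rho : arrow Q -> pathalg K Q.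
Local Notation d := (dginzburg rho).

Lemma dginzburg_linear : linear d.
Proof.
by move=> c x y; apply: val_inj; rewrite /= gdiffD gdiffZ.
Qed.

Lemma dginzburg_homogeneous n x : homogeneous n x -> homogeneous (n + 1) (d x).
Proof.
move=> xn; apply: degrees_inW (degrees_in_gdiff rho xn) => m /= <-.
by rewrite subrK.
Qed.

Lemma dginzburg_leibniz n x y : homogeneous n x ->
  d (x * y) = d x * y + (-1) ^+ `|n|%N * (x * d y).
Proof.
move=> xn; apply: val_inj; rewrite /= gdiffM; congr (_ + _).
have -> : gsign (gval x) = (-1) ^+ `|n|%N * gval x.
  have sgE : (-1) ^+ `|n|%N * gval x = (-1) ^+ `|n|%N *: gval x :> At.
    rewrite -(signr_odd At) -(signr_odd K).
    by case: (odd _); rewrite ?mulN1r ?scaleN1r ?mul1r ?scale1r.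
  apply: pathalgP => p; rewrite sgE coefZ /=.
  have [->//|npn] := eqVneq (pdeg p) n.
  have -> : gval x p = 0 by apply: xn; apply/eqP.
  by rewrite !mulr0.
rewrite -mulrA; congr (_ * _).
by rewrite -(signr_odd At) -(signr_odd (ginzburg K Q)); case: (odd _).
Qed.

Lemma gdiff_continuous : continuous (gdiff rho).
Proof.
move=> x B [n _ nB]; exists n.+1 => // y yx; apply: nB => p pn.
rewrite !coef_sum; apply: eq_bigr => b _ /=.
apply: eq_bigr => l _; apply: eq_bigr => k _; congr (_ * _ * _).
set u := ptake _ _; set w := pdrop _ _.
have [/andP[/eqP ub /eqP bw]|nubw] :=
  boolP ((ptgt u == src b) && (tgt b == psrc w)); last by rewrite !Delta0.
pose r : qpath Qt := QPath (glue_subproof ub bw : is_path (_, _).1 (_, _).2).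
rewrite !(@DeltaE _ _ _ _ _ _ _ r) //; apply: yx; rewrite ltnS; apply: leq_trans pn.
have lp : (l <= plen p)%N by rewrite -ltnS.
have kl : (k <= l)%N.
  by have := ltn_ord k; rewrite [X in (_ < X.+1)%N]plen_take // ltnS.
rewrite /plen /pword /= size_cat /= addnS ltnS -/(plen u) -/(plen w).
rewrite plen_drop [plen u]plen_take ?(leq_trans kl) ?plen_take //.
by rewrite (leq_trans (leq_add kl (leqnn _))) // subnKC.
Qed.

Lemma dginzburg_continuous : continuous d.
Proof.
apply: (@continuous_comp_initial (ginzburg K Q) _ _ (@gval K V Q)).
move=> x; apply: (@continuous_comp _ _ _ (@gval K V Q) (gdiff rho)).
  exact: initial_continuous.
exact: gdiff_continuous.
Qed.

Lemma dginzburg_idem i : d (gidem i) = 0.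
Proof. by apply: val_inj; apply: gdiff_idem. Qed.

Lemma dginzburg_arr a : d (garrelt a) = 0.
Proof. by apply: val_inj; rewrite /= gdiff_arr mulr0 mul0r. Qed.

Lemma dginzburg_dual a : hyperpotential rho -> d (gdualelt a) = ginclelt (rho a).
Proof. by case=> rhoe _; apply: val_inj; rewrite /= gdiff_dual. Qed.

Lemma dginzburg_loop i : d (tloop i) = gidem i * (\sum_a
  (garrelt a * gdualelt a - gdualelt a * garrelt a)) * gidem i.
Proof.
apply: val_inj; rewrite /= gdiff_loop; congr (_ * _ * _).
apply/esym/(big_morph (@gval K V Q)) => //.
Qed.

End Differential.

End GinzburgRing.

Arguments homogeneous {K V Q} n.
Arguments gidem K {V} Q i.
Arguments tloop K {V} Q i.

(* [Phi] preserves degrees, commutes with the differentials, and is continuous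
   on each graded piece. *)
Definition continuous_dg_isomorphism (K : comPzRingType) (V : finType)
    (Q Q' : quiver V) (rho : arrow Q -> pathalg K Q)
    (rho' : arrow Q' -> pathalg K Q')
    (Phi : {rmorphism ginzburg K Q -> ginzburg K Q'}) : Prop :=
  [/\ scalable Phi, bijective Phi,
      (forall n x, homogeneous n x -> homogeneous n (Phi x)),
      (forall x, Phi (dginzburg rho x) = dginzburg rho' (Phi x))
    & (forall n, {within homogeneous n, continuous Phi})].

(* Main.v *)
Require Import Defs.
From HB Require Import structures.
From mathcomp Require Import all_boot all_order all_algebra.
From mathcomp Require Import all_classical.
From mathcomp Require Import topology.

Import Defs.

Set Implicit Arguments.
Unset Strict Implicit.
Unset Printing Implicit Defensive.

Import Order.TTheory GRing.Theory Num.Theory.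

Local Open Scope classical_set_scope.
Local Open Scope ring_scope.

(** Degree zero of the Ginzburg algebra of [Q] is the completed path algebra [A]
    of [Q], degree [-1] is the free bimodule over it on the dual arrows [a*], and
    the differentials of the loops [t_i] are the diagonal blocks of
    [omega = sum_a [a, a*]]. An isomorphism of dg-algebras sending each [t_i] to
    [c t'_i] is therefore the same as an isomorphism [f : A -> A'] together with
    images [m_a] of the dual arrows such that

      [sum_a [f a, m_a] = c sum_b [b, b*]]    and    [d m_a = f (rho_a)].

    The first equation determines the [m_a], by two facts about commutators.

    - Leibniz rule ([sum_cycder_commutators]): for [x] in [e_i A e_j] and [m] in
      [e_j M e_i], [[x, m]] is the sum over the arrows [b] of [[b, D_b(x; m)]],
      where [D_b(x; m) = Delta_b(x) <> m] is a cyclic derivative of [x] with [m]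
      inserted at the cut. On a path this is a telescoping sum.
    - Injectivity ([commutators_eq]): elements [x_b] of degree [-1], running
      from the end of [b] to its start, are determined by [sum_b [b, x_b]].
      Comparing coefficients rotates a path one
      step at a time until it ends with its dual arrow, where nothing is left.

    Given [Phi], these facts turn the first equation into
    [sum_a D_b(f a; m_a) = c b*], and the differential of this identity is
    [f_* rho = c rho'] since [d] commutes with cyclic derivatives. The map [f],
    the degree zero part of [Phi], is bijective because [Phi] preserves degrees.

    Conversely let [f] be given, with inverse [g], and [f_* (c rho) = rho']. Put
    [z_b = sum_a D_b(f a; m_a)] for [m_a = a*], computed along [g] in the Ginzburg
    algebra of [Q]. By the Leibniz rule [sum_b [g b, z_b] = sum_a [a, a*]], and
    [d z_b] is the image under [g] of the [b]-component of [f_* rho]. So [g], extended by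
    [b* |-> c z_b] and [t'_i |-> c t_i], commutes with the differentials. The
    same construction applied to [f] and [c^-1] gives a map in the other
    direction, and injectivity shows that the two are inverse to each other.

    Two points of topology enter. The inverse of a continuous isomorphism of
    completed path algebras is continuous ([cmorph_inv]), although constant terms
    of images of loops need not vanish, only be nilpotent. And a homomorphism
    defined on the arrows of the Ginzburg quiver extends to infinite combinations
    of paths ([tends0_image]). *)

(** * Linear maps that respect the path-length filtration *)

Section LinearProps.
Variables (K : pzRingType) (U W : lmodType K) (L : U -> W).
Hypothesis L_linear : linear L.

Lemma lin_D x y : L (x + y) = L x + L y.
Proof. by have := L_linear 1 x y; rewrite !scale1r. Qed.

Lemma lin_0 : L 0 = 0.
Proof. by apply: (addrI (L 0)); rewrite -lin_D !addr0. Qed.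

Lemma lin_Z c x : L (c *: x) = c *: L x.
Proof. by have := L_linear c x 0; rewrite lin_0 !addr0. Qed.

Lemma lin_N x : L (- x) = - L x.
Proof. by apply: (addrI (L x)); rewrite -lin_D !subrr lin_0. Qed.

Lemma lin_B x y : L (x - y) = L x - L y.
Proof. by rewrite lin_D lin_N. Qed.

Lemma lin_sum (I : Type) (r : seq I) (P : pred I) (F : I -> U) :
  L (\sum_(i <- r | P i) F i) = \sum_(i <- r | P i) L (F i).
Proof. exact: (big_morph L lin_D lin_0). Qed.

End LinearProps.

Section Filtration.
Variables (K : comPzRingType) (V : finType) (Q : quiver V).
Local Notation A := (pathalg K Q).
Implicit Types (x y z : A) (p q u v w : qpath Q).

Lemma scale_mull c x y : c *: (x * y) = (c *: x) * y.
Proof.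
by apply: pathalgP => p; rewrite coefZ !coefM psumZl; apply: eq_psum => u v;
  rewrite coefZ mulrA.
Qed.

Lemma scale_mulr c x y : c *: (x * y) = x * (c *: y).
Proof.
by apply: pathalgP => p; rewrite coefZ !coefM psumZl; apply: eq_psum => u v;
  rewrite coefZ mulrCA.
Qed.

(** The closed ideal spanned by the paths of length at least [n], i.e. the
    [n]-th power of the arrow ideal. *)
Definition vanishes n x : Prop := forall p, (plen p < n)%N -> x p = 0.

Lemma vanishesW m n x : (m <= n)%N -> vanishes n x -> vanishes m x.
Proof. by move=> mn xn p pm; apply: xn; apply: leq_trans mn. Qed.

Lemma vanishes0 n : vanishes n 0.
Proof. by []. Qed.

Lemma vanishesD n x y : vanishes n x -> vanishes n y -> vanishes n (x + y).
Proof. by move=> xn yn p pn; rewrite coefD xn // yn // addr0. Qed.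

Lemma vanishesN n x : vanishes n x -> vanishes n (- x).
Proof. by move=> xn p pn; rewrite coefN xn // oppr0. Qed.

Lemma vanishes_sum n (I : Type) (r : seq I) (P : pred I) (F : I -> A) :
  (forall i, P i -> vanishes n (F i)) -> vanishes n (\sum_(i <- r | P i) F i).
Proof.
by move=> Fn; elim/big_ind: _ => // x y; apply: vanishesD.
Qed.

Lemma vanishesM m n x y : vanishes m x -> vanishes n y ->
  vanishes (m + n) (x * y).
Proof.
move=> xm yn p pmn; rewrite coefM /psum big1 // => k _.
have kp : (k <= plen p)%N by rewrite -ltnS.
have [km|mk] := ltnP k m; first by rewrite xm ?mul0r // plen_take.
rewrite yn ?mulr0 // plen_drop ltn_subLR //.
by rewrite (leq_trans pmn) // leq_add2r.
Qed.

Lemma vanishesMl n x y : vanishes n y -> vanishes n (x * y).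
Proof. exact: (@vanishesM 0%N). Qed.

Lemma vanishesMr n x y : vanishes n x -> vanishes n (x * y).
Proof. by move=> xn; rewrite -[n]addn0; apply: vanishesM. Qed.

Lemma vanishes_pbasis n p : (n <= plen p)%N -> vanishes n (pbasis K p).
Proof.
by move=> np q qn /=; case: eqP qn => // ->; rewrite ltnNge np.
Qed.

Lemma vanishes_all x : (forall n, vanishes n x) -> x = 0.
Proof. by move=> xn; apply: pathalgP => p; apply: (xn (plen p).+1). Qed.

Definition words n : seq (seq (arrow Q)) :=
  flatten [seq [seq val t | t <- enum {: k.-tuple (arrow Q)}] | k <- iota 0 n].

Definition paths n : seq (qpath Q) :=
  undup (pmap (insub : V * seq (arrow Q) -> option (qpath Q))
              (allpairs pair (enum V) (words n))).

Lemma mem_paths n p : (p \in paths n) = (plen p < n)%N.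
Proof.
rewrite /paths mem_undup mem_pmap_sub /=.
have -> : pval p = (psrc p, pword p) by rewrite /psrc /pword; case: (pval p).
apply/idP/idP => [/allpairsP[[i w] /= [_ + [_ pw]]]|pn].
  case/flatten_mapP=> k; rewrite mem_iota add0n => /andP[_ kn] /mapP[t _ wt].
  by rewrite /plen pw wt size_tuple.
apply/allpairsP; exists (psrc p, pword p); split; rewrite ?mem_enum //=.
apply/flatten_mapP; exists (plen p); first by rewrite mem_iota.
by apply/mapP; exists (in_tuple (pword p)); rewrite ?mem_enum.
Qed.

Lemma vanishes_trunc n x :
  vanishes n (x - \sum_(p <- paths n) x p *: pbasis K p).
Proof.
move=> q qn; rewrite coefD coefN coef_sum.
rewrite (bigD1_seq q) ?undup_uniq ?mem_paths //= big1 ?addr0 => [|p pq].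
  by rewrite eqxx mulr1 subrr.
by rewrite [q == p]eq_sym (negbTE pq) mulr0.
Qed.

End Filtration.

(** Continuity at zero, for the topology of the path-length filtrations. *)
Definition filtered (K : comPzRingType) (V : finType) (Q Q' : quiver V)
    (L : pathalg K Q -> pathalg K Q') : Prop :=
  forall n, exists N, forall x, vanishes N x -> vanishes n (L x).

Section Filtered.
Variables (K : comPzRingType) (V : finType) (Q Q' Q'' : quiver V).
Local Notation A := (pathalg K Q).
Local Notation A' := (pathalg K Q').

Lemma continuous_filtered (L : A -> A') : linear L ->
  continuous L -> filtered L.
Proof.
move=> Llin Lc n.
have [|N _ NL] := Lc 0 [set y | forall p, (plen p < n)%N -> y p = L 0 p].
  by exists n.
exists N => x xN p pn.
have : L x p = L 0 p by apply: NL => // q qN; rewrite xN.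
by rewrite (lin_0 Llin).
Qed.

Lemma filtered_continuous (L : A -> A') : linear L ->
  filtered L -> continuous L.
Proof.
move=> Llin Lf x B [n _ nB]; have [N NL] := Lf n; exists N => // y yx.
apply: nB => p pn; apply/eqP; rewrite -subr_eq0 -coefN -coefD -(lin_B Llin).
apply/eqP/NL => // q qN; rewrite coefD coefN yx ?subrr //.
Qed.

Lemma filteredD (L1 L2 : A -> A') : filtered L1 -> filtered L2 ->
  filtered (fun x => L1 x + L2 x).
Proof.
move=> f1 f2 n; have [N1 h1] := f1 n; have [N2 h2] := f2 n.
exists (maxn N1 N2) => x xN; apply: vanishesD.
  by apply: h1; apply: vanishesW xN; exact: leq_maxl.
by apply: h2; apply: vanishesW xN; exact: leq_maxr.
Qed.

Lemma filteredN (L : A -> A') : filtered L -> filtered (fun x => - L x).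
Proof. by move=> f n; have [N h] := f n; exists N => x /h /vanishesN. Qed.

Lemma filteredB (L1 L2 : A -> A') : filtered L1 -> filtered L2 ->
  filtered (fun x => L1 x - L2 x).
Proof. by move=> f1 f2; apply: filteredD => //; apply: filteredN. Qed.

Lemma filtered_sum (I : finType) (L : I -> A -> A') :
  (forall i, filtered (L i)) -> filtered (fun x => \sum_i L i x).
Proof.
move=> Lf n; have h i := Lf i n; have [N hN] := choice h.
exists (\max_i N i) => x xN; apply: vanishes_sum => i _.
by apply: hN; apply: vanishesW xN; apply: leq_bigmax.
Qed.

Lemma filteredMl (L : A -> A') y : filtered L -> filtered (fun x => y * L x).
Proof. by move=> f n; have [N h] := f n; exists N => x /h; apply: vanishesMl. Qed.

Lemma filteredMr (L : A -> A') y : filtered L -> filtered (fun x => L x * y).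
Proof. by move=> f n; have [N h] := f n; exists N => x /h; apply: vanishesMr. Qed.

Lemma filtered_comp (L : A -> A') (L' : A' -> pathalg K Q'') :
  filtered L -> filtered L' -> filtered (fun x => L' (L x)).
Proof.
move=> f f' n; have [N h'] := f' n; have [M h] := f N.
by exists M => x /h /h'.
Qed.

(** Finite combinations of paths are dense, so a continuous linear map is
    determined by its values on the paths. *)
Lemma eq_on_paths (L1 L2 : A -> A') : linear L1 -> linear L2 ->
  filtered L1 -> filtered L2 ->
  (forall p, L1 (pbasis K p) = L2 (pbasis K p)) -> forall x, L1 x = L2 x.
Proof.
move=> l1 l2 f1 f2 L12 x; apply/eqP; rewrite -subr_eq0; apply/eqP.
apply: vanishes_all => n; have [N h] := filteredB f1 f2 n.
rewrite -[x](subrK (\sum_(p <- paths Q N) x p *: pbasis K p)).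
rewrite (lin_D l1) (lin_D l2) opprD addrACA.
have -> : L1 (\sum_(p <- paths Q N) x p *: pbasis K p) =
          L2 (\sum_(p <- paths Q N) x p *: pbasis K p).
  rewrite (lin_sum l1) (lin_sum l2); apply: eq_bigr => p _.
  by rewrite (lin_Z l1) (lin_Z l2) L12.
by rewrite subrr addr0; apply: h; apply: vanishes_trunc.
Qed.

(** The condition under which [F] is the restriction to the paths of a
    continuous linear map. *)
Definition tends0 (F : qpath Q -> A') : Prop :=
  forall n, exists N, forall p, (N <= plen p)%N -> vanishes n (F p).

(** For [F] as above each coefficient of the value is a finite sum; otherwise the
    finitely supported sum may be zero by default. *)
Definition linext (F : qpath Q -> A') (x : A) : A' :=
  PathAlg (fun q => \sum_(p \in [set: qpath Q]) x p * F p q).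

Lemma linextE (F : qpath Q -> A') n x q : (forall p, (n <= plen p)%N -> F p q = 0) ->
  linext F x q = \sum_(p <- paths Q n) x p * F p q.
Proof.
move=> F0; rewrite /= (fsbigE (paths Q n)) ?undup_uniq //.
  by apply: eq_bigl => p; apply/asboolP.
by move=> p _; rewrite mem_paths -leqNgt => /F0->; rewrite mulr0.
Qed.

Section LinExt.
Variable F : qpath Q -> A'.
Hypothesis F0 : tends0 F.

Lemma tends0_coef q : exists N, forall p, (N <= plen p)%N -> F p q = 0.
Proof.
by have [N h] := F0 (plen q).+1; exists N => p /h; apply; rewrite ltnS.
Qed.

Lemma linext_linear : linear (linext F).
Proof.
move=> c x y; apply: pathalgP => q; have [N h] := tends0_coef q.
rewrite coefD coefZ !(linextE _ h) mulr_sumr -big_split; apply: eq_bigr => p _.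
by rewrite coefD coefZ mulrDl mulrA.
Qed.

Lemma linext_filtered : filtered (linext F).
Proof.
move=> n; have [N h] := F0 n; exists N => x xN q qn.
have hq p : (N <= plen p)%N -> F p q = 0 by move=> /h; apply.
rewrite (linextE _ hq) big_seq big1 // => p.
by rewrite mem_paths => /xN->; rewrite mul0r.
Qed.

Lemma linext_pbasis p : linext F (pbasis K p) = F p.
Proof.
apply: pathalgP => q; have [N h] := tends0_coef q.
rewrite (@linextE _ (maxn N (plen p).+1)) => [|r]; last first.
  by rewrite geq_max => /andP[/h].
rewrite (bigD1_seq p) ?undup_uniq ?mem_paths ?leq_maxr //= eqxx mul1r.
by rewrite big1 ?addr0 // => r /negbTE->; rewrite mul0r.
Qed.

End LinExt.

End Filtered.

Lemma linext_comp (K : comPzRingType) (V : finType) (Q Q' Q'' : quiver V)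
    (F : qpath Q -> pathalg K Q') (G : qpath Q -> pathalg K Q'')
    (L : pathalg K Q' -> pathalg K Q'') :
  linear L -> filtered L -> tends0 F -> (forall p, L (F p) = G p) ->
  forall x, L (linext F x) = linext G x.
Proof.
move=> Llin Lf F0 LFG.
have G0 : tends0 G.
  move=> n; have [N h] := Lf n; have [M h'] := F0 N.
  by exists M => p /h' /h; rewrite LFG.
apply: eq_on_paths.
- by move=> c x y; rewrite linext_linear // Llin.
- exact: linext_linear.
- by apply: filtered_comp => //; apply: linext_filtered.
- exact: linext_filtered.
by move=> p; rewrite !linext_pbasis.
Qed.

(** * Products of paths *)

Section PathProducts.
Variables (K : comPzRingType) (V : finType) (Q : quiver V).
Local Notation A := (pathalg K Q).
Implicit Types (x y z : A) (p q u v w : qpath Q).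

Lemma idemE i p : idem K Q i p = ((plen p == 0%N) && (psrc p == i))%:R.
Proof.
congr (nat_of_bool _)%:R; apply/eqP/andP => [->//|[/eqP/size0nil p0 /eqP pi]].
exact: qpathE.
Qed.

Lemma idem_mull i x p : (idem K Q i * x) p = (psrc p == i)%:R * x p.
Proof.
rewrite coefM /psum big_ord_recl big1 => [|k _]; last first.
  by rewrite idemE plen_take ?lift0 // mul0r.
by rewrite idemE ptake0 pdrop0 addr0.
Qed.

Lemma pdrop_plen p : pdrop (plen p) p = ptriv Q (ptgt p).
Proof.
apply: qpathE; last by rewrite /pword /= drop_size.
by rewrite /psrc /= take_size.
Qed.

Lemma idem_mulr i x p : (x * idem K Q i) p = (ptgt p == i)%:R * x p.
Proof.
rewrite coefM /psum big_ord_recr big1 => [|k _]; last first.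
  rewrite idemE plen_drop; have := ltn_ord k; rewrite -subn_gt0 lt0n /=.
  by move/negbTE->; rewrite mulr0.
rewrite [LHS]add0r idemE plen_drop subnn /= ptake_plen mulrC.
by rewrite pdrop_plen.
Qed.

Lemma idem_pbasis i p :
  idem K Q i * pbasis K p = if psrc p == i then pbasis K p else 0.
Proof.
apply: pathalgP => q; rewrite idem_mull /=; case: (q =P p) => [->|qp].
  by rewrite mulr1; case: ifP => //= _; rewrite eqxx.
by rewrite mulr0; case: ifP => //= _; move/eqP/negbTE: qp => ->.
Qed.

Lemma pbasis_idem i p :
  pbasis K p * idem K Q i = if ptgt p == i then pbasis K p else 0.
Proof.
apply: pathalgP => q; rewrite idem_mulr /=; case: (q =P p) => [->|qp].
  by rewrite mulr1; case: ifP => //= _; rewrite eqxx.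
by rewrite mulr0; case: ifP => //= _; move/eqP/negbTE: qp => ->.
Qed.

Lemma idemM i j : idem K Q i * idem K Q j = if i == j then idem K Q i else 0.
Proof.
by rewrite idem_pbasis [psrc _]/= eq_sym; case: (i =P j) => [->|].
Qed.

Lemma idem_sqr i : idem K Q i * idem K Q i = idem K Q i.
Proof. by rewrite idemM eqxx. Qed.

Lemma sum_idem : \sum_i idem K Q i = 1.
Proof.
apply: pathalgP => p; rewrite coef_sum coef1 (bigD1 (psrc p)) //= big1.
  by rewrite addr0 -/(idem K Q _ p) [LHS](idemE (psrc p) p) eqxx andbT.
by move=> i /negbTE ip; rewrite [LHS](idemE i p) [psrc p == i]eq_sym ip andbF.
Qed.

Lemma pbasis_split k p : (k <= plen p)%N ->
  pbasis K (ptake k p) * pbasis K (pdrop k p) = pbasis K p.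
Proof.
move=> kp; apply: pathalgP => q; rewrite coefM /psum /=.
have [->|/eqP qp] := q =P p.
  rewrite (bigD1 (Ordinal (kp : (k < (plen p).+1)%N))) //= !eqxx mulr1.
  rewrite big1 ?addr0 // => l lk; case: eqP => [e|]; last by rewrite mul0r.
  have lp : (l <= plen p)%N by rewrite -ltnS.
  have e' : l = k :> nat by rewrite -(plen_take kp) -(plen_take lp) e.
  by case/eqP: lk; apply: val_inj.
rewrite big1 // => l _; case: eqP => [e|]; last by rewrite mul0r.
case: eqP => [e'|]; last by rewrite mulr0.
case/eqP: qp; apply: qpathE; first by have := congr1 (@psrc V Q) e.
rewrite -(cat_take_drop l (pword q)) -(cat_take_drop k (pword p)).
by congr (_ ++ _); [have := congr1 (@pword V Q) e|have := congr1 (@pword V Q) e'].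
Qed.

Lemma pword_take k p : pword (ptake k p) = take k (pword p).
Proof. by []. Qed.

Lemma pword_drop k p : pword (pdrop k p) = drop k (pword p).
Proof. by []. Qed.

Lemma ptake_nth a k p : (k < plen p)%N ->
  pbasis K (ptake k.+1 p)
  = pbasis K (ptake k p) * arr K (nth a (pword p) k).
Proof.
move=> kp; set b := nth a _ _.
rewrite -(@pbasis_split k (ptake k.+1 p)) ?plen_take //.
have nb : nth b (pword p) k = b by rewrite /b (set_nth_default a).
have [h1 h2 h3] := pval_glue kp nb.
congr (_ * _); congr pbasis; apply: qpathE => //.
- by rewrite /pword /= take_takel.
- by rewrite /psrc /= take_takel // -h1.
- rewrite pword_drop pword_take (take_nth b) // nb -cats1 drop_size_cat //.
  by rewrite size_takel // ltnW.
Qed.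

Lemma pdrop_nth a k p : (k < plen p)%N ->
  pbasis K (pdrop k p)
  = arr K (nth a (pword p) k) * pbasis K (pdrop k.+1 p).
Proof.
move=> kp; set b := nth a _ _.
have nb : nth b (pword p) k = b by rewrite /b (set_nth_default a).
have [h1 h2 h3] := pval_glue kp nb.
rewrite -(@pbasis_split 1 (pdrop k p)) ?plen_drop ?subn_gt0 //.
congr (_ * _); congr pbasis; apply: qpathE => //.
- by rewrite pword_take pword_drop (drop_nth b kp) /= take0 nb.
- rewrite -h2 -[LHS]/(ptgt (ptake 1 (pdrop k p))) /ptgt pword_take pword_drop.
  rewrite (drop_nth b kp) /= take0 nb.
  by rewrite /endpoint.
- by rewrite /pword /= drop_drop add1n.
Qed.

Lemma ptake_0 p : ptake 0 p = ptriv Q (psrc p).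
Proof. by apply: qpathE; rewrite // /pword /= take0. Qed.

Lemma pbasis_ind (P : A -> Prop) : (forall i, P (idem K Q i)) ->
  (forall a x, P x -> P (arr K a * x)) -> forall p, P (pbasis K p).
Proof.
move=> P0 P1 p; have [n np] := ubnP (plen p); elim: n => // n IH in p np *.
have [/eqP p0|p0] := posnP (plen p).
  have -> : p = ptriv Q (psrc p) by apply: qpathE => //; apply: size0nil (eqP p0).
  exact: P0.
case E: (pword p) => [|a s]; first by rewrite /plen E in p0.
rewrite -[p]pdrop0 (pdrop_nth a p0) E; apply: P1; apply: IH.
by rewrite plen_drop subn1; case: (plen p) p0 np.
Qed.

Lemma arrE a : idem K Q (src a) * arr K a * idem K Q (tgt a) = arr K a.
Proof. by rewrite idem_pbasis eqxx pbasis_idem eqxx. Qed.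

Lemma vanishes_arr (a : arrow Q) : vanishes 1 (arr K a).
Proof. exact: vanishes_pbasis. Qed.

Lemma arr_mull (a : arrow Q) y p : (arr K a * y) p = (0 < plen p)%N%:R *
    ((ptake 1 p == parrow a)%:R * y (pdrop 1 p)).
Proof.
rewrite coefM /psum; have [p0|p0] := posnP (plen p).
  rewrite mul0r big1 // => k _ /=; case: eqP => [e|]; last by rewrite mul0r.
  have kp : (k <= plen p)%N by rewrite -ltnS.
  by have := kp; rewrite -(plen_take kp) e p0.
rewrite (bigD1 (Ordinal (p0 : (1 < (plen p).+1)%N))) //= mul1r big1 ?addr0 //.
move=> k k1; case: (ptake k p =P _) => [e|]; last by rewrite mul0r.
have kp : (k <= plen p)%N by rewrite -ltnS.
have e' : k = 1%N :> nat by rewrite -(plen_take kp) e.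
by case/eqP: k1; apply: val_inj.
Qed.

Lemma arr_mulr (a : arrow Q) y p : (y * arr K a) p = (0 < plen p)%N%:R *
    (y (ptake (plen p).-1 p) * (pdrop (plen p).-1 p == parrow a)%:R).
Proof.
rewrite coefM /psum; have [p0|p0] := posnP (plen p).
  rewrite mul0r big1 // => k _ /=; case: eqP => [e|]; last by rewrite mulr0.
  have := leq_subr k (plen p).
  by rewrite -plen_drop e [X in (_ <= X)%N]p0.
have p1 : ((plen p).-1 < (plen p).+1)%N by rewrite prednK.
rewrite (bigD1 (Ordinal p1)) //= mul1r big1 ?addr0 //.
move=> k k1; case: (pdrop k p =P _) => [e|]; last by rewrite mulr0.
have kp : (k <= plen p)%N by rewrite -ltnS.
have e' : (plen p - k = 1)%N by rewrite -plen_drop e.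
case/eqP: k1; apply: val_inj => /=.
by have := congr1 predn (subnK kp); rewrite e'.
Qed.

(** Splitting the paths of length at least [m + n] after their first [m]
    arrows: the [(m + n)]-th power of the arrow ideal is additively spanned by
    products of elements of its [m]-th and [n]-th powers, without closure. *)
Lemma vanishesM_ind (P : A -> Prop) m n :
  P 0 -> (forall x y, P x -> P y -> P (x + y)) ->
  (forall x y, vanishes m x -> vanishes n y -> P (x * y)) ->
  forall x, vanishes (m + n) x -> P x.
Proof.
elim: m P => [|m IH] P P0 PD PM x xmn; first by rewrite -[x]mul1r; apply: PM.
pose quot a : A := PathAlg (fun q =>
  if tgt a == psrc q
  then oapp (coef x) 0 (insub (src a, a :: pword q)) else 0).
have -> : x = \sum_a arr K a * quot a.
  apply: pathalgP => p; rewrite coef_sum.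
  have [p0|p0] := posnP (plen p).
    by rewrite xmn ?p0 // big1 // => a _; rewrite arr_mull p0 mul0r.
  case E: (pword p) => [|a s]; first by rewrite /plen E in p0.
  have na : nth a (pword p) 0 = a by rewrite E.
  have [h1 h2 h3] := pval_glue p0 na.
  have tk : ptake 1 p = parrow a.
    by apply: qpathE; [rewrite -[RHS]h1 /ptgt /endpoint /pword /= take0|
      rewrite /pword /= -/(pword p) E /= take0].
  rewrite (bigD1 a) // arr_mull p0 tk eqxx !mul1r big1 => [|b /negbTE ba].
    rewrite [RHS]addr0 /= -h2 eqxx.
    have -> : (src a, a :: pword (pdrop 1 p)) = pval p.
      by rewrite h3 /pword /= take0 -h1 /ptgt /endpoint /= /pword /= take0.
    by rewrite valK.
  rewrite arr_mull tk; case: eqP => [e|]; last by rewrite !(mul0r, mulr0).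
  by have := congr1 (@pword V Q) e => -[ab]; rewrite ab eqxx in ba.
elim/big_ind: _ => // a _; apply: (IH (fun y => P (arr K a * y))).
- by rewrite mulr0.
- by move=> y z Py Pz; rewrite mulrDr; apply: PD.
- move=> y z ym zn; rewrite mulrA; apply: PM => //.
  exact: (vanishesM (@vanishes_arr a)).
move=> q qmn /=; case: eqP => // aq; case: insubP => //= p _ pE.
apply: xmn; rewrite /plen /pword pE /=.
by rewrite addSn ltnS.
Qed.

End PathProducts.

(** * Continuous homomorphisms of completed path algebras *)

(** Preservation of the unit follows from that of the [idem i], whose sum is [1].
    Bare functions are used so that compositions such as [gincl \o g] need no
    packaging. *)
Record cmorph (K : comPzRingType) (V : finType) (Q Q' : quiver V)
    (f : pathalg K Q -> pathalg K Q') : Prop := CMorph {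
  cm_linear : linear f;
  cm_mul : {morph f : x y / x * y};
  cm_filtered : filtered f;
  cm_idem : forall i, f (idem K Q i) = idem K Q' i
}.

Lemma linear_id (K : pzRingType) (U : lmodType K) : linear (@id U).
Proof. by []. Qed.

Lemma linear_comp (K : pzRingType) (U U' U'' : lmodType K) (f : U -> U')
    (g : U' -> U'') : linear f -> linear g -> linear (fun x => g (f x)).
Proof. by move=> fl gl c x y; rewrite fl gl. Qed.

Lemma linear_addf (K : pzRingType) (U U' : lmodType K) (f g : U -> U') :
  linear f -> linear g -> linear (fun x => f x + g x).
Proof. by move=> fl gl c x y; rewrite fl gl scalerDr addrACA. Qed.

Lemma linear_oppf (K : pzRingType) (U U' : lmodType K) (f : U -> U') :
  linear f -> linear (fun x => - f x).
Proof. by move=> fl c x y; rewrite fl opprD scalerN. Qed.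

Lemma linear_subf (K : pzRingType) (U U' : lmodType K) (f g : U -> U') :
  linear f -> linear g -> linear (fun x => f x - g x).
Proof. by move=> fl gl; apply: linear_addf => //; apply: linear_oppf. Qed.

Lemma linear_sumf (K : pzRingType) (U U' : lmodType K) (I : finType)
    (f : I -> U -> U') :
  (forall i, linear (f i)) -> linear (fun x => \sum_i f i x).
Proof.
move=> fl c x y; rewrite scaler_sumr -big_split; apply: eq_bigr => i _.
by rewrite fl.
Qed.

Section LinearMul.
Variables (K : comPzRingType) (V : finType) (Q : quiver V) (U : lmodType K).
Variables (f : U -> pathalg K Q).
Hypothesis f_linear : linear f.

Lemma linear_mull y : linear (fun x => y * f x).
Proof. by move=> c u v; rewrite f_linear mulrDr scale_mulr. Qed.

Lemma linear_mulr y : linear (fun x => f x * y).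
Proof. by move=> c u v; rewrite f_linear mulrDl scale_mull. Qed.

End LinearMul.

Section CMorphTheory.
Variables (K : comPzRingType) (V : finType).

Lemma cmorph_id (Q : quiver V) : cmorph (@id (pathalg K Q)).
Proof. by split=> // n; exists n. Qed.

Lemma cmorph_comp (Q Q' Q'' : quiver V) (f : pathalg K Q -> pathalg K Q')
    (g : pathalg K Q' -> pathalg K Q'') :
  cmorph f -> cmorph g -> cmorph (fun x => g (f x)).
Proof.
case=> fl fm ff fe [gl gm gf ge]; split.
- exact: linear_comp.
- by move=> x y; rewrite fm gm.
- exact: filtered_comp.
- by move=> i; rewrite fe ge.
Qed.

Lemma cm_1 (Q Q' : quiver V) (f : pathalg K Q -> pathalg K Q') :
  cmorph f -> f 1 = 1.
Proof.
move=> fP; rewrite -!sum_idem (lin_sum (cm_linear fP)).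
by apply: eq_bigr => i _; rewrite cm_idem.
Qed.

Lemma cmorph_eq (Q Q' : quiver V) (f g : pathalg K Q -> pathalg K Q') :
  cmorph f -> cmorph g -> (forall a, f (arr K a) = g (arr K a)) ->
  forall x, f x = g x.
Proof.
case=> fl fm ff fe [gl gm gf ge] fg; apply: eq_on_paths => // p.
apply: (pbasis_ind (P := fun x => f x = g x)) => [i|a x IH].
  by rewrite fe ge.
by rewrite fm gm fg IH.
Qed.

Lemma cm_arr (Q Q' : quiver V) (f : pathalg K Q -> pathalg K Q') a :
  cmorph f ->
  idem K Q' (src a) * f (arr K a) * idem K Q' (tgt a) = f (arr K a).
Proof. by move=> fP; rewrite -!(cm_idem fP) -!(cm_mul fP) arrE. Qed.

Definition const_coef (Q : quiver V) i (x : pathalg K Q) : K := x (ptriv Q i).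

Lemma const_coefM (Q : quiver V) i (x y : pathalg K Q) :
  const_coef i (x * y) = const_coef i x * const_coef i y.
Proof.
rewrite /const_coef coefM /psum big_ord1.
by congr (x _ * y _); apply: qpathE.
Qed.

Lemma vanishes1P (Q : quiver V) (x : pathalg K Q) :
  (forall i, const_coef i x = 0) -> vanishes 1 x.
Proof.
move=> x0 p; rewrite ltnS leqn0 => /eqP/size0nil p0.
have -> : p = ptriv Q (psrc p) by apply: qpathE.
exact: x0.
Qed.

Section Inverse.
Variables (Q Q' : quiver V).
Variables (f : pathalg K Q -> pathalg K Q') (g : pathalg K Q' -> pathalg K Q).
Hypotheses (fP : cmorph f) (fK : cancel f g) (gK : cancel g f).

Lemma cm_inv_linear : linear g.
Proof. by move=> c x y; apply: (can_inj fK); rewrite (cm_linear fP) !gK. Qed.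

Lemma cm_inv_mul : {morph g : x y / x * y}.
Proof. by move=> x y; apply: (can_inj fK); rewrite (cm_mul fP) !gK. Qed.

Lemma cm_inv_idem i : g (idem K Q' i) = idem K Q i.
Proof. by apply: (can_inj fK); rewrite (cm_idem fP) !gK. Qed.

(** With [c] the constant coefficient of [g x] at [i], the element
    [g x * e_i - c e_i] has no constant term, and [f] sends it to
    [x * e_i - c e_i], whose constant coefficient at [i] is [- c] when [x] has
    no constant term. The general case follows by multiplicativity. *)
Lemma const_coef_inv i n x : vanishes n x ->
  exists2 y, vanishes n y & const_coef i (g x) = const_coef i (f y).
Proof.
elim: n x => [|n IH] x xn.
  exists (const_coef i (g x) *: (1 : pathalg K Q)) => //.
  rewrite (lin_Z (cm_linear fP)) (cm_1 fP) /const_coef coefZ coef1 /=.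
  by rewrite mulr1.
move: x xn; rewrite -[n.+1]add1n; apply: vanishesM_ind.
- exists 0; first exact: vanishes0.
  by rewrite (lin_0 (cm_linear fP)) (lin_0 cm_inv_linear).
- move=> x1 x2 [y1 h1 e1] [y2 h2 e2]; exists (y1 + y2); first exact: vanishesD.
  rewrite (lin_D (cm_linear fP)) (lin_D cm_inv_linear) /const_coef !coefD.
  by congr (_ + _).
move=> x1 x2 x1n x2n; have [y2 h2 e2] := IH _ x2n.
pose c := const_coef i (g x1).
pose y1 := c *: idem K Q i - g x1 * idem K Q i.
exists (y1 * y2).
  apply: vanishesM => //; apply: vanishes1P => j.
  rewrite /const_coef coefD coefN coefZ idem_mulr.
  rewrite -[idem K Q i _]/(idem K Q i (ptriv Q j)) idemE /=.
  rewrite -[psrc _]/j -[ptgt _]/j; case: eqP => [->|_].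
    by rewrite mulr1 mul1r subrr.
  by rewrite mulr0 mul0r subrr.
rewrite cm_inv_mul (cm_mul fP) !const_coefM -e2; congr (_ * _).
rewrite (lin_B (cm_linear fP)) (cm_mul fP) (lin_Z (cm_linear fP)) gK.
rewrite (cm_idem fP) /const_coef coefD coefN idem_mulr x1n // mulr0 subr0.
by rewrite coefZ idemE /= eqxx mulr1.
Qed.

(** By [const_coef_inv], [g] sends the [N]-th power of the arrow ideal into the
    arrow ideal as soon as [f] does; multiplicativity then gives all powers. *)
Lemma cmorph_inv : cmorph g.
Proof.
split; [exact: cm_inv_linear|exact: cm_inv_mul| |exact: cm_inv_idem].
have [N fN] := cm_filtered fP 1.
have g1 x : vanishes N x -> vanishes 1 (g x).
  move=> xN; apply: vanishes1P => i.
  have [y yN ->] := const_coef_inv i xN; exact: fN.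
move=> n; exists (n * N)%N; elim: n => [//|n IH].
rewrite mulSn; apply: vanishesM_ind.
- by rewrite (lin_0 cm_inv_linear); apply: vanishes0.
- by move=> y z; rewrite (lin_D cm_inv_linear); apply: vanishesD.
move=> y z yN zN; rewrite cm_inv_mul -[n.+1]add1n.
by apply: vanishesM; [apply: g1|apply: IH].
Qed.

End Inverse.

Section Substitution.
Variables (Q Q' : quiver V) (f : arrow Q -> pathalg K Q').
Hypothesis fe : forall a, idem K Q' (src a) * f a * idem K Q' (tgt a) = f a.

(** The trivial path in front gives the right value when [p] has length zero, and
    is absorbed by the first factor otherwise. *)
Definition path_subst (p : qpath Q) : pathalg K Q' :=
  idem K Q' (psrc p) * \prod_(a <- pword p) f a.

Hypothesis f0 : tends0 path_subst.

Let F := linext path_subst.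

Lemma image_idem_l a : idem K Q' (src a) * f a = f a.
Proof. by rewrite -fe !mulrA idem_sqr. Qed.

Lemma image_idem_r a : f a * idem K Q' (tgt a) = f a.
Proof. by rewrite -fe -!mulrA idem_sqr. Qed.

Lemma subst_arr a : F (arr K a) = f a.
Proof. by rewrite /F linext_pbasis // /path_subst big_seq1 image_idem_l. Qed.

Lemma subst_idem i : F (idem K Q i) = idem K Q' i.
Proof. by rewrite /F linext_pbasis // /path_subst big_nil mulr1. Qed.

Lemma path_subst_l p : idem K Q' (psrc p) * path_subst p = path_subst p.
Proof. by rewrite /path_subst mulrA idem_sqr. Qed.

Lemma subst_idem_mul i y : F (idem K Q i * y) = idem K Q' i * F y.
Proof.
apply: (eq_on_paths (L1 := fun y => F (idem K Q i * y))
                    (L2 := fun y => idem K Q' i * F y)).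
- apply: linear_comp (@linext_linear _ _ _ _ _ f0).
  exact: linear_mull (@linear_id _ _) _.
- exact: linear_mull (@linext_linear _ _ _ _ _ f0) _.
- apply: filtered_comp (@linext_filtered _ _ _ _ _ f0).
  by apply: filteredMl => n; exists n.
- exact/filteredMl/(linext_filtered f0).
move=> p; rewrite idem_pbasis /F linext_pbasis // -path_subst_l mulrA idemM.
rewrite eq_sym; case: eqP => [->|_].
  by rewrite linext_pbasis // path_subst_l.
by rewrite (lin_0 (linext_linear f0)) mul0r.
Qed.

Lemma subst_arr_mul a y : F (arr K a * y) = f a * F y.
Proof.
apply: (eq_on_paths (L1 := fun y => F (arr K a * y))
                    (L2 := fun y => f a * F y)).
- apply: linear_comp (@linext_linear _ _ _ _ _ f0).
  exact: linear_mull (@linear_id _ _) _.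
- exact: linear_mull (@linext_linear _ _ _ _ _ f0) _.
- apply: filtered_comp (@linext_filtered _ _ _ _ _ f0).
  by apply: filteredMl => n; exists n.
- exact/filteredMl/(linext_filtered f0).
move=> p; rewrite [F (pbasis K p)]/F linext_pbasis //.
have [ap|ap] := eqVneq (tgt a) (psrc p); last first.
  have -> : pbasis K p = idem K Q (psrc p) * pbasis K p.
    by rewrite idem_pbasis eqxx.
  rewrite -arrE -image_idem_r -path_subst_l -!mulrA.
  rewrite (mulrA (idem K Q (tgt a))) (mulrA (idem K Q' (tgt a))) !idemM.
  by rewrite (negbTE ap) !(mul0r, mulr0) /F (lin_0 (linext_linear f0)).
have rP : is_path (src a) (a :: pword p).
  by rewrite /= eqxx ap; apply: (qpathP p).
pose r := @QPath V Q (src a, a :: pword p) rP.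
have -> : arr K a * pbasis K p = pbasis K r.
  rewrite -(@pbasis_split K V Q 1 r) //; congr (_ * _); congr pbasis.
    by apply: qpathE; rewrite // /pword /= take0.
  by apply: qpathE; rewrite /pword /psrc /= ?drop0 // take0.
rewrite /F linext_pbasis // /path_subst big_cons mulrA image_idem_l mulrA.
by rewrite -ap image_idem_r.
Qed.

Lemma cmorph_subst : cmorph F.
Proof.
split; [exact: linext_linear| |exact: linext_filtered|exact: subst_idem].
move=> x y; apply: (eq_on_paths (L1 := fun x => F (x * y))
                    (L2 := fun x => F x * F y)).
- apply: linear_comp (@linext_linear _ _ _ _ _ f0).
  exact: linear_mulr (@linear_id _ _) _.
- exact: linear_mulr (@linext_linear _ _ _ _ _ f0) _.
- apply: filtered_comp (@linext_filtered _ _ _ _ _ f0).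
  by apply: filteredMr => n; exists n.
- exact/filteredMr/(linext_filtered f0).
apply: (pbasis_ind (P := fun x => F (x * y) = F x * F y)) => [i|a z IH].
  by rewrite subst_idem subst_idem_mul.
by rewrite -mulrA !subst_arr_mul IH mulrA.
Qed.

End Substitution.

End CMorphTheory.

(** * Cyclic derivatives *)

Section CyclicDerivative.
Variables (K : comPzRingType) (V : finType) (Q Q' : quiver V).
Implicit Types (f : pathalg K Q -> pathalg K Q') (m : pathalg K Q').
Implicit Types (p : qpath Q) (b : arrow Q).

Definition path_cycder f b m p : pathalg K Q' :=
  \sum_(k < plen p | nth b (pword p) k == b)
    f (pbasis K (pdrop k.+1 p)) * m * f (pbasis K (ptake k p)).

(** The cyclic derivative along [f], with [m] inserted at the cut. When [f] is the
    identity it is the action of [Delta b x] on [m], see [diamond_Delta]. *)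
Definition cycder f b m : pathalg K Q -> pathalg K Q' :=
  linext (path_cycder f b m).

Lemma tends0_path_cycder f b m : filtered f -> tends0 (path_cycder f b m).
Proof.
move=> ff n; have [N fN] := ff n; exists (N + N).+1 => p Np.
apply: vanishes_sum => k _; have [Nk|kN] := leqP N k.
  apply: vanishesMl; apply: fN; apply: vanishes_pbasis.
  by rewrite plen_take // ltnW.
apply: vanishesMr; apply: vanishesMr; apply: fN; apply: vanishes_pbasis.
rewrite plen_drop leq_subRL ?ltn_ord //.
by rewrite (leq_trans _ Np) // addSn ltnS leq_add2r ltnW.
Qed.

Lemma cycder_linear f b m : filtered f -> linear (cycder f b m).
Proof. by move=> ff; apply/linext_linear/tends0_path_cycder. Qed.

Lemma cycder_filtered f b m : filtered f -> filtered (cycder f b m).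
Proof. by move=> ff; apply/linext_filtered/tends0_path_cycder. Qed.

Lemma cycder_pbasis f b m p : filtered f ->
  cycder f b m (pbasis K p) = path_cycder f b m p.
Proof. by move=> ff; apply/linext_pbasis/tends0_path_cycder. Qed.

(** Exactly one arrow occurs at each position. The default [b] of [nth] does not
    interfere, the positions lying within the word. *)
Lemma sum_occurrences (W : nmodType) p (G : arrow Q -> nat -> W) H :
  (forall b k, (k < plen p)%N -> nth b (pword p) k = b -> G b k = H k) ->
  \sum_b \sum_(k < plen p | nth b (pword p) k == b) G b k
  = \sum_(k < plen p) H k.
Proof.
move=> GH; rewrite (exchange_big_dep xpredT) //=; apply: eq_bigr => k _.
have default j : (j < plen p)%N -> arrow Q by rewrite /plen; case: (pword p).
have kp := ltn_ord k; pose b := nth (default k kp) (pword p) k.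
have nb c : nth c (pword p) k = b by apply: set_nth_default.
rewrite (big_pred1 b) => [|c]; first by apply: GH => //; apply: nb.
by rewrite nb eq_sym.
Qed.

(** Each occurrence of an arrow in a path [p] contributes the difference of two
    rotations of [p] by consecutive amounts, so the sum over the occurrences
    telescopes. *)
Lemma sum_cycder_commutators f m x : cmorph f ->
  \sum_b (f (arr K b) * cycder f b m x - cycder f b m x * f (arr K b))
  = \sum_i idem K Q' i * (f x * m - m * f x) * idem K Q' i.
Proof.
move=> fP; have [fl fm ff fe] := fP.
apply: (eq_on_paths (L1 := fun x =>
    \sum_b (f (arr K b) * cycder f b m x - cycder f b m x * f (arr K b)))
  (L2 := fun x => \sum_i idem K Q' i * (f x * m - m * f x) * idem K Q' i)).
- apply: linear_sumf => b; have dl := cycder_linear b m ff.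
  by apply: linear_subf; [apply: linear_mull|apply: linear_mulr].
- apply: linear_sumf => i; apply: linear_mulr; apply: linear_mull.
  by apply: linear_subf; [apply: linear_mulr|apply: linear_mull].
- apply: filtered_sum => b; have df := cycder_filtered b m ff.
  by apply: filteredB; [apply: filteredMl|apply: filteredMr].
- apply: filtered_sum => i; apply: filteredMr; apply: filteredMl.
  by apply: filteredB; [apply: filteredMr|apply: filteredMl].
move=> p; pose H k := f (pbasis K (pdrop k p)) * m * f (pbasis K (ptake k p)).
transitivity (\sum_(k < plen p) (H k - H k.+1)).
  rewrite -(@sum_occurrences _ p (fun b k =>
    f (arr K b) * (f (pbasis K (pdrop k.+1 p)) * m * f (pbasis K (ptake k p)))
    - f (pbasis K (pdrop k.+1 p)) * m * f (pbasis K (ptake k p)) * f (arr K b))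
    (fun k => H k - H k.+1)).
    apply: eq_bigr => b _; rewrite cycder_pbasis // /path_cycder.
    by rewrite mulr_sumr mulr_suml -sumrB.
  move=> b k kp nb; rewrite /H (pdrop_nth K b kp) (ptake_nth K b kp) nb !fm.
  by rewrite !mulrA.
have -> : \sum_(k < plen p) (H k - H k.+1) = H 0%N - H (plen p).
  elim: (plen p) => [|n IH]; first by rewrite big_ord0 subrr.
  by rewrite big_ord_recr /= IH addrA subrK.
rewrite /H pdrop0 ptake_plen pdrop_plen ptake_0 !fe.
have fpl i : idem K Q' i * f (pbasis K p) =
    if psrc p == i then f (pbasis K p) else 0.
  by rewrite -fe -fm idem_pbasis; case: ifP => // _; rewrite (lin_0 fl).
have fpr i : f (pbasis K p) * idem K Q' i =
    if ptgt p == i then f (pbasis K p) else 0.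
  by rewrite -fe -fm pbasis_idem; case: ifP => // _; rewrite (lin_0 fl).
under eq_bigr => i _ do rewrite mulrBr mulrBl mulrA fpl -!mulrA fpr.
rewrite sumrB (bigD1 (psrc p)) //= eqxx big1 ?addr0 => [|i /negbTE ip]; last first.
  by rewrite eq_sym ip mul0r.
congr (_ - _); first by rewrite mulrA.
rewrite (bigD1 (ptgt p)) //= eqxx big1 ?addr0 ?mulrA // => i /negbTE ip.
by rewrite eq_sym ip !mulr0.
Qed.

End CyclicDerivative.

Section CyclicDerivativeMaps.
Variables (K : comPzRingType) (V : finType) (Q Q' Q'' : quiver V).

(** The naturality by which both homomorphisms and the differential, which is
    linear over elements of degree zero, pass inside cyclic derivatives. *)
Lemma cycder_map (f : pathalg K Q -> pathalg K Q')
    (g : pathalg K Q -> pathalg K Q'')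
    (L : pathalg K Q' -> pathalg K Q'') b m m' x :
  filtered f -> linear L -> filtered L ->
  (forall u w, L (f u * m * f w) = g u * m' * g w) ->
  L (cycder f b m x) = cycder g b m' x.
Proof.
move=> ff Ll Lf Lfg; apply: linext_comp => // [|p].
  exact: tends0_path_cycder.
by rewrite (lin_sum Ll); apply: eq_bigr => k _; rewrite Lfg.
Qed.

Lemma cycder_cmorph (f : pathalg K Q -> pathalg K Q')
    (g : pathalg K Q' -> pathalg K Q'') b m x :
  cmorph f -> cmorph g ->
  g (cycder f b m x) = cycder (fun y => g (f y)) b (g m) x.
Proof.
move=> fP gP; apply: cycder_map; first exact: cm_filtered.
- exact: cm_linear.
- exact: cm_filtered.
by move=> u w; rewrite !(cm_mul gP).
Qed.

Lemma cycder_idem (f : pathalg K Q -> pathalg K Q') b m x : cmorph f ->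
  idem K Q' (tgt b) * cycder f b m x * idem K Q' (src b) = cycder f b m x.
Proof.
case=> fl fm ff fe; apply: (linext_comp
  (L := fun y => idem K Q' (tgt b) * y * idem K Q' (src b))).
- apply: linear_mulr; exact: linear_mull (@linear_id _ _) _.
- by apply: filteredMr; apply: filteredMl => n; exists n.
- exact: tends0_path_cycder.
move=> p; rewrite /path_cycder mulr_sumr mulr_suml; apply: eq_bigr => k /eqP nb.
have [h1 h2 _] := pval_glue (ltn_ord k) nb.
rewrite -!fe !mulrA -fm idem_pbasis h2 eqxx -!mulrA -fm pbasis_idem h1.
by rewrite eqxx.
Qed.

Lemma diamond_Delta b (x r : pathalg K Q) :
  diamond (Delta b x) r = cycder id b r x.
Proof.
apply: (eq_on_paths (L1 := fun x => diamond (Delta b x) r)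
                    (L2 := cycder id b r)).
- move=> c y z; apply: pathalgP => p; rewrite coefD coefZ /= psumZl -psumD.
  apply: eq_psum => q w; rewrite psumZl -psumD; apply: eq_psum => u v.
  by rewrite DeltaD DeltaZ mulrDl mulrA.
- by apply: cycder_linear => n; exists n.
- move=> n; exists n.+1 => y yn p pn /=.
  rewrite /psum big1 // => l _; rewrite big1 // => k _.
  set u := pdrop l p; set w := ptake k _.
  have [/andP[/eqP ub /eqP bw]|nub] :=
    boolP ((ptgt u == src b) && (tgt b == psrc w)); last by rewrite Delta0 ?mul0r.
  pose q : qpath Q := QPath (glue_subproof ub bw : is_path (_, _).1 (_, _).2).
  rewrite (@DeltaE _ _ _ _ _ _ _ q) // yn ?mul0r //.
  have lp : (l <= plen p)%N by rewrite -ltnS.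
  have kl : (k <= l)%N.
    by have := ltn_ord k; rewrite [X in (_ < X.+1)%N]plen_take // ltnS.
  have -> : plen q = (plen u + plen w).+1.
    by rewrite /plen /pword /= size_cat /= addnS.
  rewrite ltnS (leq_ltn_trans _ pn) // plen_drop.
  have kq : (k <= plen (ptake l p))%N by rewrite -ltnS.
  rewrite [plen w]plen_take //.
  by rewrite (leq_trans (leq_add (leqnn _) kl)) // subnK.
- by apply: cycder_filtered => n; exists n.
move=> p; rewrite cycder_pbasis; last by move=> n; exists n.
apply: pathalgP => q; rewrite /path_cycder.
have -> : diamond (Delta b (pbasis K p)) r =
  \sum_(k < plen p | nth b (pword p) k == b) diamond (fun u w =>
     pbasis K (ptake k p) u * pbasis K (pdrop k.+1 p) w) r.
  apply: pathalgP => s; rewrite coef_sum /= /psum exchange_big.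
  apply: eq_bigr => l _; rewrite exchange_big; apply: eq_bigr => j _.
  by rewrite Delta_pbasis mulr_suml.
by rewrite !coef_sum; apply: eq_bigr => k _; rewrite diamond_tens.
Qed.

End CyclicDerivativeMaps.

(** * The degree-zero part of the Ginzburg algebra *)

Section DegreeZero.
Variables (K : comPzRingType) (V : finType) (Q : quiver V).
Local Notation Qt := (ginzburg_quiver Q).
Local Notation At := (pathalg K Qt).
Implicit Types (x y : pathalg K Q) (z : At) (p q : qpath Qt) (r : qpath Q).

Lemma plen_gpath r : plen (gpath r) = plen r.
Proof. by rewrite /plen /pword /= size_map. Qed.

Lemma gincl_linear : linear (@gincl K V Q).
Proof.
move=> c x y; apply: pathalgP => q; rewrite coefD coefZ.
have [/plain_gpath[r ->]|npl] :=
  boolP (all (fun g => isSome (plain g)) (pword q)).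
  by rewrite !gincl_gpath coefD coefZ.
by rewrite !gincl_out // mulr0 addr0.
Qed.

Lemma vanishes_gincl n x : vanishes n x -> vanishes n (gincl x).
Proof.
move=> xn q qn.
have [/plain_gpath[r qr]|npl] :=
  boolP (all (fun g => isSome (plain g)) (pword q)); last exact: gincl_out.
by rewrite qr gincl_gpath xn // -plen_gpath -qr.
Qed.

Lemma gincl_filtered : filtered (@gincl K V Q).
Proof. by move=> n; exists n => x; apply: vanishes_gincl. Qed.

Lemma cmorph_gincl : cmorph (@gincl K V Q).
Proof.
split; [exact: gincl_linear|exact: ginclM|exact: gincl_filtered|].
exact: gincl_idem.
Qed.

Lemma gincl_arr (a : arrow Q) : gincl (arr K a) = arr K (garr a).
Proof.
apply: pathalgP => q; have [/plain_gpath[r ->]|npl] :=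
  boolP (all (fun g => isSome (plain g)) (pword q)).
  rewrite gincl_gpath /=; congr (nat_of_bool _)%:R; apply/eqP/eqP => [->|e].
    exact: qpathE.
  apply: qpathE; first by have := congr1 (@psrc V Qt) e.
  have /= := congr1 (@pword V Qt) e; rewrite /pword /=.
  by case: (r) => [[i [|b [|c w]]]] //= _ [->].
by rewrite gincl_out //=; case: eqP npl => // ->.
Qed.

(** The projection that kills the arrows of negative degree. *)
Definition gproj z : pathalg K Q := PathAlg (fun r => z (gpath r)).

Lemma gprojK : cancel (@gincl K V Q) gproj.
Proof. by move=> x; apply: pathalgP => r; apply: gincl_gpath. Qed.

Lemma ginclK z : degrees_in [set 0] z -> gincl (gproj z) = z.
Proof.
move=> z0; apply: pathalgP => q.
have [/plain_gpath[r ->]|npl] :=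
  boolP (all (fun g => isSome (plain g)) (pword q)).
  by rewrite gincl_gpath.
rewrite gincl_out // z0 //= => q0; case/negP: npl; rewrite /pdeg in q0.
elim: (pword q) q0 => //= g s IH; rewrite big_cons => gs.
have deg_le0 (t : seq (garrow Q)) : \sum_(h <- t) gdeg h <= 0 :> int.
  by elim/big_rec: _ => // -[[a|a]|i] m _ m0; rewrite /= ?add0r // ler_wnDl.
have := deg_le0 s; case: g gs => [[a|a]|i] /=.
- by rewrite add0r => /IH.
- by move=> /eqP; rewrite addrC subr_eq0 => /eqP->.
- by move=> /eqP; rewrite addrC subr_eq0 => /eqP->.
Qed.

Lemma gproj_linear : linear gproj.
Proof. by move=> c x y; apply: pathalgP => r. Qed.

Lemma gprojM : {morph gproj : x y / x * y}.
Proof.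
move=> x y; apply: pathalgP => r; rewrite coefM /= /psum plen_gpath.
apply: eq_bigr => k _; congr (x _ * y _); apply: qpathE => //.
- by rewrite /pword /= map_take.
- rewrite /psrc /pword /= -map_take /endpoint -map_comp.
  by congr last; apply: eq_map.
- by rewrite /pword /= map_drop.
Qed.

(** * The differential *)

Lemma gdiff_linear rho : linear (@gdiff K V Q rho).
Proof. by move=> c x y; rewrite gdiffD gdiffZ. Qed.

Lemma gdiff_filtered rho : filtered (@gdiff K V Q rho).
Proof.
by apply: continuous_filtered; [exact: gdiff_linear|exact: gdiff_continuous].
Qed.

Lemma gdiff_gincl rho x : gdiff rho (gincl x) = 0.
Proof.
apply: (eq_on_paths (L1 := fun x => gdiff rho (gincl x)) (L2 := fun=> 0)).
- exact: linear_comp gincl_linear (gdiff_linear rho).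
- by move=> c u v; rewrite scaler0 addr0.
- exact: filtered_comp gincl_filtered (gdiff_filtered rho).
- by move=> n; exists n.
apply: (pbasis_ind (P := fun x => gdiff rho (gincl x) = 0)) => [i|a y IH].
  by rewrite gincl_idem gdiff_idem.
by rewrite ginclM gdiffM IH gincl_arr gdiff_arr !(mulr0, mul0r) addr0.
Qed.

Lemma gsign_homogeneous n z : degrees_in [set n] z ->
  gsign z = (-1) ^+ `|n|%N *: z.
Proof.
move=> zn; apply: pathalgP => p; rewrite coefZ /=.
have [->//|/eqP pn] := eqVneq (pdeg p) n.
by rewrite (zn p) ?mulr0.
Qed.

Lemma gsign_linear : linear (@gsign K V Q).
Proof.
move=> c x y; apply: pathalgP => p; rewrite coefD coefZ /=.
by rewrite mulrDr mulrCA.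
Qed.

Lemma gsign_filtered : filtered (@gsign K V Q).
Proof. by move=> n; exists n => x xn p pn /=; rewrite xn ?mulr0. Qed.

(** Elements of degree zero are cycles and bring no sign. *)
Lemma gdiff_plain_bimodule rho x y z :
  gdiff rho (gincl x * z * gincl y) = gincl x * gdiff rho z * gincl y.
Proof.
rewrite gdiffM gdiff_gincl mulr0 addr0 gdiffM gdiff_gincl mul0r add0r.
rewrite (gsign_homogeneous (degrees_in_gincl x)) /=.
by rewrite scale1r.
Qed.

Lemma diag_id i (z : At) :
  idem K Qt i * z * idem K Qt i = z ->
  \sum_j idem K Qt j * z * idem K Qt j = z.
Proof.
move=> zi; rewrite (bigD1 i) //= zi big1 ?addr0 // => j /negbTE ji.
by rewrite -zi !mulrA idemM ji !mul0r.
Qed.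

(** The elements [g z] and [z g] are concentrated at one vertex each, so nothing
    is lost by cutting to the diagonal, as the differentials of the loops do. *)
Lemma diag_commutator g (z : At) :
  idem K Qt (tgt g) * z * idem K Qt (src g) = z ->
  \sum_i idem K Qt i * (arr K g * z - z * arr K g) * idem K Qt i
  = arr K g * z - z * arr K g.
Proof.
move=> ze; have zl : idem K Qt (tgt g) * z = z.
  by rewrite -ze !mulrA idem_sqr.
have zr : z * idem K Qt (src g) = z by rewrite -ze -!mulrA idem_sqr.
have gl : idem K Qt (src g) * arr K g = arr K g by rewrite idem_pbasis eqxx.
have gr : arr K g * idem K Qt (tgt g) = arr K g by rewrite pbasis_idem eqxx.
under eq_bigr => i _ do rewrite mulrBr mulrBl.
rewrite sumrB; congr (_ - _).
  by apply: (diag_id (i := src g)); rewrite mulrA gl -mulrA zr.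
by apply: (diag_id (i := tgt g)); rewrite mulrA zl -mulrA gr.
Qed.

End DegreeZero.

(** * Commutators with the arrows of degree zero *)

Section CommutatorInjectivity.
Variables (K : comPzRingType) (V : finType) (Q : quiver V).
Local Notation Qt := (ginzburg_quiver Q).
Local Notation At := (pathalg K Qt).
Implicit Types (b : arrow Q) (p q : qpath Qt).

Lemma split_last_nonplain (s : seq (garrow Q)) :
  ~~ all (fun g => isSome (plain g)) s ->
  exists u g v, plain g = None /\ s = u ++ g :: map (@garr V Q) v.
Proof.
elim/last_ind: s => // s h IH; rewrite all_rcons negb_and.
case: h => [[a|a]|i] /= => [/IH|_|_].
- case=> u [g [v [gp ->]]]; exists u, g, (rcons v a).
  by rewrite rcons_cat map_rcons.
- by exists s, (inl (inr a)), [::]; rewrite cats1.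
- by exists s, (inr i), [::]; rewrite cats1.
Qed.

Lemma nonplain_deg p : pdeg p != 0 ->
  ~~ all (fun g => isSome (plain g)) (pword p).
Proof.
apply: contra => /plain_gpath[r ->].
by rewrite /pdeg /pword /= big_map big1.
Qed.

Section Rotation.
Variable x : arrow Q -> At.
Hypothesis x_deg : forall b, degrees_in [set -1] (x b).
Hypothesis x_idem :
  forall b, idem K Qt (tgt b) * x b * idem K Qt (src b) = x b.
Hypothesis x_comm : \sum_b (arr K (garr b) * x b - x b * arr K (garr b)) = 0.

(** This compares the coefficients of the vanishing sum at the path [b q]. *)
Lemma rotate_coef b q w h : psrc q = tgt b -> pword q = rcons w h ->
  exists2 r, pword r = garr b :: w & x b q = \sum_c x c r * (h == garr c)%:R.
Proof.
move=> qb qw; have pP : @is_path V Qt (src b) (garr b :: pword q).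
  by rewrite /= eqxx -qb; apply: (qpathP q).
pose p : qpath Qt := @QPath V Qt (src b, garr b :: pword q) pP.
have pE : pword p = rcons (garr b :: w) h by rewrite /p {1}/pword /= qw.
have lp : (plen p).-1 = size (garr b :: w) by rewrite /plen pE size_rcons.
have pq : pdrop 1 p = q.
  by apply: qpathE; rewrite /psrc /pword /= ?drop0 // take0 /endpoint /= -qb.
have tp : ptake 1 p = parrow (garr b).
  by apply: qpathE; rewrite // /pword /= take0.
exists (ptake (plen p).-1 p).
  by rewrite pword_take pE lp -cats1 take_size_cat.
apply/eqP; rewrite -subr_eq0; apply/eqP.
rewrite -[RHS]/((0 : At) p) -x_comm coef_sum.
under [RHS]eq_bigr => c _ do rewrite coefD coefN arr_mull arr_mulr !mul1r pq tp.
rewrite sumrB; congr (_ - _).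
  rewrite (bigD1 b) //= eqxx mul1r big1 ?addr0 // => c /negbTE cb.
  case: eqP => [e|]; last by rewrite mul0r.
  by have := congr1 (@pword V Qt) e => -[bc]; rewrite bc eqxx in cb.
apply: eq_bigr => c _; congr (_ * (nat_of_bool _)%:R).
have dE : pword (pdrop (plen p).-1 p) = [:: h].
  by rewrite pword_drop pE lp -cats1 drop_size_cat.
apply/eqP/eqP => [hc|e]; last first.
  by have := congr1 (@pword V Qt) e; rewrite dE => -[].
apply: qpathE; last by rewrite dE hc.
have := qpathP (pdrop (plen p).-1 p).
by rewrite -/(psrc _) -/(pword _) dE /= hc andbT => /eqP <-.
Qed.

(** Rotating a path past its final arrows in [Q], until it ends with an arrow
    outside [Q], shows that its coefficient is zero. *)
Lemma commutators_injective b : x b = 0.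
Proof.
suff coef0 v : forall b q u g, plain g = None ->
    pword q = u ++ g :: map (@garr V Q) v -> x b q = 0.
  apply: pathalgP => q; rewrite [RHS]/=.
  have [q1|q1] := eqVneq (pdeg q) (-1); last first.
    by apply: x_deg => /= /eqP; apply/negP.
  have [|u [g [v [gp qE]]]] := @split_last_nonplain (pword q).
    by apply: nonplain_deg; rewrite q1.
  exact: coef0 gp qE.
elim/last_ind: v => [|v c IH] {}b q u g gp qE.
all: have [qb|/negbTE qb] := eqVneq (psrc q) (tgt b);
  last by rewrite -x_idem -mulrA idem_mull qb mul0r.
  have [|r rE ->] := rotate_coef (w := u) (h := g) qb.
    by rewrite qE cats1.
  rewrite big1 // => c _; case: eqP gp => [->//|_ _].
  by rewrite mulr0.
have [|r rE ->] := rotate_coef (w := u ++ g :: map (@garr V Q) v)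
  (h := garr c) qb.
  by rewrite qE map_rcons rcons_cat.
rewrite big1 // => a _; rewrite (IH a r (garr b :: u) g) ?mul0r //.
Qed.

End Rotation.

Lemma commutators_eq (x y : arrow Q -> At) :
  (forall b, degrees_in [set -1] (x b)) ->
  (forall b, idem K Qt (tgt b) * x b * idem K Qt (src b) = x b) ->
  (forall b, degrees_in [set -1] (y b)) ->
  (forall b, idem K Qt (tgt b) * y b * idem K Qt (src b) = y b) ->
  \sum_b (arr K (garr b) * x b - x b * arr K (garr b))
  = \sum_b (arr K (garr b) * y b - y b * arr K (garr b)) ->
  forall b, x b = y b.
Proof.
move=> xd xe yd ye xy b; apply/eqP; rewrite -subr_eq0; apply/eqP.
apply: (commutators_injective (x := fun b => x b - y b)) => [a|a|].
- by apply: degrees_inD => //; apply: degrees_inN.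
- by rewrite mulrBr mulrBl xe ye.
rewrite -[RHS](subrr (\sum_b (arr K (garr b) * y b - y b * arr K (garr b)))).
rewrite -{1}xy -sumrB; apply: eq_bigr => a _.
by rewrite mulrBr mulrBl !opprD !opprK addrACA.
Qed.

End CommutatorInjectivity.

(** * Extending homomorphisms to the Ginzburg algebras *)

Definition degree_preserving (K : comPzRingType) (V : finType) (Q Q' : quiver V)
    (f : pathalg K (ginzburg_quiver Q) -> pathalg K (ginzburg_quiver Q')) :=
  forall D x, degrees_in D x -> degrees_in D (f x).

Section Extension.
Variables (K : comPzRingType) (V : finType) (Q Q' : quiver V).
Local Notation Qt := (ginzburg_quiver Q).
Local Notation Qt' := (ginzburg_quiver Q').

(** Only the paths [p] of the degree of [q] contribute to the coefficient at
    [q]. *)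
Lemma linext_degrees (F : qpath Qt -> pathalg K Qt') : tends0 F ->
  (forall p, degrees_in [set pdeg p] (F p)) -> degree_preserving (linext F).
Proof.
move=> F0 Fdeg D x xD q nDq; have [N h] := tends0_coef F0 q.
rewrite (linextE _ h) big1 // => p _.
have [pq|/eqP pq] := eqVneq (pdeg q) (pdeg p).
  by rewrite xD ?mul0r // -pq.
by rewrite Fdeg ?mulr0.
Qed.

Variables (f : pathalg K Q -> pathalg K Q') (z : arrow Q -> pathalg K Qt').
Variable c : K.
Hypothesis fP : cmorph f.
Hypothesis z_deg : forall a, degrees_in [set -1] (z a).
Hypothesis z_idem :
  forall a, idem K Qt' (tgt a) * z a * idem K Qt' (src a) = z a.

Definition garrow_image (g : arrow Qt) : pathalg K Qt' :=
  match g with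
  | inl (inl a) => gincl (f (arr K a))
  | inl (inr a) => z a
  | inr i => c *: arr K (gloop Q' i)
  end.

Lemma garrow_image_idem g : idem K Qt' (src g) * garrow_image g *
  idem K Qt' (tgt g) = garrow_image g.
Proof.
case: g => [[a|a]|i] /=; last 2 first.
- exact: z_idem.
- by rewrite -scale_mulr -scale_mull (arrE K (gloop Q' i)).
exact: (cm_arr a (cmorph_comp fP (@cmorph_gincl _ _ _))).
Qed.

Lemma garrow_image_deg g : degrees_in [set gdeg g] (garrow_image g).
Proof.
case: g => [[a|a]|i] /=; [exact: degrees_in_gincl|exact: z_deg|].
by apply: degrees_inZ; apply: (@degrees_in_arr K V Q' (gloop Q' i)).
Qed.

(** The trivial paths have degree zero, so elements of negative degree have no
    constant term. *)
Lemma garrow_image_vanishes g : plain g = None ->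
  vanishes 1 (garrow_image g).
Proof.
move=> gp p; rewrite ltnS leqn0 => /eqP/size0nil p0.
apply: garrow_image_deg; rewrite /= /pdeg -/(pword p) p0 big_nil.
by case: g gp => [[a|a]|i].
Qed.

Let F := path_subst garrow_image.

Lemma path_subst_deg p : degrees_in [set pdeg p] (F p).
Proof.
rewrite /F /path_subst -[pdeg p]add0r; apply: degrees_inM1.
  exact: degrees_in_idem.
rewrite /pdeg; elim: (pword p) => [|g s IH].
  rewrite !big_nil -sum_idem; apply: degrees_in_sum => i.
  exact: degrees_in_idem.
by rewrite !big_cons; apply: degrees_inM1 => //; apply: garrow_image_deg.
Qed.

Let W (s : seq (arrow Qt)) := \prod_(g <- s) garrow_image g.

(** On the paths of [Q] the substitution is [f], so its continuity there is that
    of [f]. *)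
Lemma path_subst_gpath (r : qpath Q) : F (gpath r) = gincl (f (pbasis K r)).
Proof.
have [n rn] := ubnP (plen r); elim: n => // n IH in r rn *.
have [/eqP r0|r0] := posnP (plen r).
  have -> : r = ptriv Q (psrc r) by apply: qpathE => //; apply: size0nil (eqP r0).
  by rewrite -[pbasis K _]/(idem K Q _) cm_idem // gincl_idem /F /path_subst
     big_nil mulr1.
case E: (pword r) => [|a s]; first by rewrite /plen E in r0.
have a0 : nth a (pword r) 0 = a by rewrite E.
have [h1 h2 h3] := pval_glue r0 a0.
rewrite -[in RHS](pdrop0 r) (pdrop_nth K a r0) a0 (cm_mul fP) ginclM -IH; last first.
  by rewrite plen_drop subn1; case: (plen r) r0 rn.
have wE : pword r = a :: pword (pdrop 1 r) by rewrite pword_drop E /= drop0.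
rewrite /F /path_subst -[pword (gpath r)]/(map (@garr V Q) (pword r)) wE.
rewrite /= big_cons -[psrc (gpath (pdrop 1 r))]/(psrc (pdrop 1 r)) -h2.
rewrite !mulrA -[psrc (gpath r)]/(psrc r).
have -> : psrc r = src a by rewrite -h1 /ptgt /endpoint pword_take take0.
by rewrite (image_idem_l garrow_image_idem (garr a)) (image_idem_r garrow_image_idem (garr a)).
Qed.

(** A long path either has many arrows outside [Q], each of which contributes
    to the length of its image, or contains a long path of [Q], whose image is
    long because [f] is continuous. *)
Lemma tends0_image : tends0 F.
Proof.
have ff : filtered (fun x => gincl (f x)).
  exact: filtered_comp (cm_filtered fP) (@gincl_filtered _ _ _).
elim=> [|n [M IH]]; first by exists 0%N.
have [N fN] := ff n.+1; exists (N + M).+1 => p Mp.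
have Np : (N <= plen p)%N by rewrite (leq_trans _ Mp) // -addnS leq_addr.
have [/plain_gpath[r rE]|] :=
  boolP (all (fun g => isSome (plain g)) (pword (ptake N p))).
  have -> : F p = F (ptake N p) * W (drop N (pword p)).
    by rewrite /F /path_subst -mulrA -big_cat pword_take cat_take_drop.
  rewrite rE path_subst_gpath; apply: vanishesMr; apply: fN.
  by apply: vanishes_pbasis; rewrite -plen_gpath -rE plen_take.
rewrite pword_take => /allPn[g gN gp].
have [s1 [s2 sE]] : exists s1 s2, take N (pword p) = s1 ++ g :: s2.
  by case/splitPr: gN => s1 s2; exists s1, s2.
(* The first [N] arrows of [p] contain an arrow [g] outside [Q]: its image adds
   one to the length, and more than [M] arrows follow it. *)
pose k := size s1; have kN : (k < N)%N.
  by rewrite -(size_takel Np) sE size_cat /= addnS ltnS leq_addr.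
have kp : (k < plen p)%N by apply: leq_trans Np.
have pE : pword p = s1 ++ g :: (s2 ++ drop N (pword p)).
  by rewrite -[LHS](cat_take_drop N) sE -catA.
have gk : nth g (pword p) k = g by rewrite pE nth_cat ltnn subnn.
have [h1 h2 h3] := pval_glue kp gk.
have -> : F p = (idem K Qt' (psrc p) * W s1) *
    (garrow_image g * F (pdrop k.+1 p)).
  rewrite /F /path_subst -h2 [garrow_image g * (_ * _)]mulrA (image_idem_r garrow_image_idem g) -mulrA.
  congr (_ * _); rewrite pE big_cat big_cons pword_drop [in drop k.+1 (pword p)]pE; congr (_ * (_ * _)).
  by rewrite drop_cat ltnNge leqnSn /= subSnn /= drop0.
apply: vanishesMl; rewrite -add1n; apply: vanishesM.
  by apply: garrow_image_vanishes; case: (plain g) gp.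
apply: IH; rewrite plen_drop leq_subRL // (leq_trans _ Mp) // addSn ltnS.
by rewrite leq_add2r ltnW.
Qed.

Definition ginzburg_ext : pathalg K Qt -> pathalg K Qt' :=
  linext (path_subst garrow_image).

Lemma cmorph_ext : cmorph ginzburg_ext.
Proof. exact: cmorph_subst garrow_image_idem tends0_image. Qed.

Lemma ext_degrees : degree_preserving ginzburg_ext.
Proof. exact: linext_degrees tends0_image path_subst_deg. Qed.

Lemma ext_arr g : ginzburg_ext (arr K g) = garrow_image g.
Proof. exact: subst_arr garrow_image_idem tends0_image g. Qed.

Lemma ext_gincl x : ginzburg_ext (gincl x) = gincl (f x).
Proof.
apply: (cmorph_eq (f := fun x => ginzburg_ext (gincl x))
                  (g := fun x => gincl (f x))).
- exact: cmorph_comp (@cmorph_gincl _ _ _) cmorph_ext.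
- exact: cmorph_comp fP (@cmorph_gincl _ _ _).
by move=> a; rewrite gincl_arr ext_arr.
Qed.

End Extension.

(** * Homomorphisms commuting with the differentials *)

Section Differentials.
Variables (K : comPzRingType) (V : finType) (Q Q' : quiver V).
Local Notation Qt := (ginzburg_quiver Q).
Local Notation Qt' := (ginzburg_quiver Q').
Variables (F : pathalg K Qt -> pathalg K Qt').
Hypotheses (FP : cmorph F) (Fdeg : degree_preserving F).

Lemma gsign_cmorph x : gsign (F x) = F (gsign x).
Proof.
apply: (eq_on_paths (L1 := fun x => gsign (F x)) (L2 := fun x => F (gsign x))).
- exact: linear_comp (cm_linear FP) (@gsign_linear _ _ _).
- exact: linear_comp (@gsign_linear _ _ _) (cm_linear FP).
- exact: filtered_comp (cm_filtered FP) (@gsign_filtered _ _ _).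
- exact: filtered_comp (@gsign_filtered _ _ _) (cm_filtered FP).
move=> p; have pd := @degrees_in_pbasis K V Q p.
rewrite (gsign_homogeneous (Fdeg pd)) (gsign_homogeneous pd).
by rewrite (lin_Z (cm_linear FP)).
Qed.

Lemma gdiff_cmorph rho rho' :
  (forall g, gdiff rho' (F (arr K g)) = F (gdiff rho (arr K g))) ->
  forall x, gdiff rho' (F x) = F (gdiff rho x).
Proof.
move=> Fd; apply: eq_on_paths.
- exact: linear_comp (cm_linear FP) (gdiff_linear _).
- exact: linear_comp (gdiff_linear _) (cm_linear FP).
- exact: filtered_comp (cm_filtered FP) (gdiff_filtered _).
- exact: filtered_comp (gdiff_filtered _) (cm_filtered FP).
apply: (pbasis_ind (P := fun x => gdiff rho' (F x) = F (gdiff rho x))) => [i|g x IH].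
  by rewrite (cm_idem FP) !gdiff_idem (lin_0 (cm_linear FP)).
rewrite (cm_mul FP) !gdiffM Fd gsign_cmorph IH.
by rewrite (lin_D (cm_linear FP)) !(cm_mul FP).
Qed.

End Differentials.

(** * Transferring the dual arrows *)

Section Transfer.
Variables (K : comPzRingType) (V : finType) (Q Q' Q0 : quiver V).
Local Notation Qt := (ginzburg_quiver Q0).
Variables (f : pathalg K Q -> pathalg K Q') (g : pathalg K Q' -> pathalg K Q0).
Variable m : arrow Q -> pathalg K Qt.
Hypotheses (gP : cmorph g) (m_deg : forall a, degrees_in [set -1] (m a)).

Local Notation theta := (fun x => gincl (g x)).

Let thetaP : cmorph theta.
Proof. exact: cmorph_comp gP (@cmorph_gincl _ _ _). Qed.

(** The dual arrows transform by the transpose of the Jacobian of [f], whose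
    entries are the double derivatives [Delta b (f a)]. *)
Definition transfer (b : arrow Q') : pathalg K Qt :=
  \sum_a cycder theta b (m a) (f (arr K a)).

Lemma transfer_deg b : degrees_in [set -1] (transfer b).
Proof.
apply: degrees_in_sum => a q nq.
have F0 := tends0_path_cycder b (m a) (cm_filtered thetaP).
have [N h] := tends0_coef F0 q; rewrite (linextE _ h) big1 // => p _.
suff -> : path_cycder theta b (m a) p q = 0 by rewrite mulr0.
move: q nq {h}; rewrite -/(degrees_in _ _) /path_cycder -big_filter.
elim/big_rec: _ => // k y _ yd; apply: degrees_inD => //.
have -> : [set -1] = [set 0 + -1 + 0 : int] by rewrite add0r addr0.
by apply: degrees_inM1; [apply: degrees_inM1 => //|]; apply: degrees_in_gincl.
Qed.

Lemma transfer_idem b :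
  idem K Qt (tgt b) * transfer b * idem K Qt (src b) = transfer b.
Proof.
rewrite /transfer mulr_sumr mulr_suml; apply: eq_bigr => a _.
exact: cycder_idem.
Qed.

Lemma transfer_commutators :
  \sum_b (theta (arr K b) * transfer b - transfer b * theta (arr K b))
  = \sum_i idem K Qt i * (\sum_a (theta (f (arr K a)) * m a
                                - m a * theta (f (arr K a)))) * idem K Qt i.
Proof.
transitivity (\sum_a \sum_b
  (theta (arr K b) * cycder theta b (m a) (f (arr K a))
   - cycder theta b (m a) (f (arr K a)) * theta (arr K b))).
  rewrite exchange_big; apply: eq_bigr => b _.
  by rewrite /transfer mulr_sumr mulr_suml sumrB.
under eq_bigr => a _ do rewrite sum_cycder_commutators //.
rewrite exchange_big; apply: eq_bigr => i _.
by rewrite mulr_sumr mulr_suml.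
Qed.

(** The definition of [transfer] mirrors that of [pushforward], with the elements
    [m a] in place of their differentials. *)
Lemma transfer_gdiff rho r b :
  (forall a, gdiff rho (m a) = theta (f (r a))) ->
  gdiff rho (transfer b) = theta (pushforward f r b).
Proof.
move=> rhor; rewrite /transfer /pushforward (lin_sum (gdiff_linear rho)).
rewrite (lin_sum (cm_linear thetaP)); apply: eq_bigr => a _.
rewrite diamond_Delta (cycder_cmorph _ _ _ (@cmorph_id K V Q') thetaP) -rhor.
apply: cycder_map.
- exact: cm_filtered thetaP.
- exact: gdiff_linear.
- exact: gdiff_filtered.
by move=> u w; rewrite gdiff_plain_bimodule.
Qed.

End Transfer.

Section Gsum.
Variables (K : comPzRingType) (V : finType) (Q : quiver V).
Local Notation Qt := (ginzburg_quiver Q).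

Lemma gdual_idem (a : arrow Q) : idem K Qt (tgt a) * arr K (gdual a) *
  idem K Qt (src a) = arr K (gdual a).
Proof. exact: (arrE K (gdual a)). Qed.

Lemma gsum_diag : \sum_i idem K Qt i * gsum_commutators K Q * idem K Qt i
  = gsum_commutators K Q.
Proof.
rewrite /gsum_commutators.
under eq_bigr => i _ do rewrite mulr_sumr mulr_suml.
rewrite exchange_big; apply: eq_bigr => a _.
by rewrite (diag_commutator (g := garr a)) // gdual_idem.
Qed.

End Gsum.

(** * From an isomorphism of path algebras to one of Ginzburg algebras *)

Section Lift.
Variables (K : comPzRingType) (V : finType) (Q Q' : quiver V).
Local Notation Qt := (ginzburg_quiver Q).
Local Notation Qt' := (ginzburg_quiver Q').
Variables (f : pathalg K Q -> pathalg K Q') (g : pathalg K Q' -> pathalg K Q).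
Variable c : K.
Hypotheses (gP : cmorph g) (fK : cancel f g).

Definition dual_image (b : arrow Q') : pathalg K Qt :=
  transfer f g (fun a => arr K (gdual a)) b.

Lemma dual_image_deg b : degrees_in [set -1] (c *: dual_image b).
Proof.
apply: degrees_inZ; apply: transfer_deg => // a.
exact: (@degrees_in_arr K V Q (gdual a)).
Qed.

Lemma dual_image_idem b : idem K Qt (tgt b) * (c *: dual_image b) *
  idem K Qt (src b) = c *: dual_image b.
Proof. by rewrite -scale_mulr -scale_mull transfer_idem. Qed.

Definition ginzburg_lift : pathalg K Qt' -> pathalg K Qt :=
  ginzburg_ext g (fun b => c *: dual_image b) c.

Lemma cmorph_lift : cmorph ginzburg_lift.
Proof. exact: cmorph_ext gP dual_image_deg dual_image_idem. Qed.

Lemma ginzburg_lift_degrees : degree_preserving ginzburg_lift.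
Proof. exact: ext_degrees gP dual_image_deg dual_image_idem. Qed.

Lemma ginzburg_lift_gincl x : ginzburg_lift (gincl x) = gincl (g x).
Proof. exact: ext_gincl gP dual_image_deg dual_image_idem x. Qed.

Lemma ginzburg_lift_arr h :
  ginzburg_lift (arr K h) = garrow_image g (fun b => c *: dual_image b) c h.
Proof. exact: ext_arr gP dual_image_deg dual_image_idem h. Qed.

Lemma ginzburg_lift_commutators : ginzburg_lift (gsum_commutators K Q') = c *: gsum_commutators K Q.
Proof.
rewrite /gsum_commutators (lin_sum (cm_linear cmorph_lift)).
transitivity (c *: \sum_b (gincl (g (arr K b)) * dual_image b
                           - dual_image b * gincl (g (arr K b)))).
  rewrite scaler_sumr; apply: eq_bigr => b _.
  rewrite (lin_B (cm_linear cmorph_lift)) !(cm_mul cmorph_lift) !ginzburg_lift_arr /=.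
  by rewrite -scale_mulr -scale_mull scalerBr.
rewrite transfer_commutators //; congr (_ *: _); rewrite -[RHS]gsum_diag.
apply: eq_bigr => i _; congr (_ * _ * _); apply: eq_bigr => a _.
by rewrite fK gincl_arr.
Qed.

(** On the dual arrows this is [transfer_gdiff], on the loops it is
    [ginzburg_lift_commutators]. *)
Lemma ginzburg_lift_gdiff rho rho' : hyperpotential rho -> hyperpotential rho' ->
  (forall b, c *: pushforward f rho b = rho' b) ->
  forall x, gdiff rho (ginzburg_lift x) = ginzburg_lift (gdiff rho' x).
Proof.
move=> hrho hrho' frho; have Ll := cm_linear cmorph_lift.
apply: gdiff_cmorph; [exact: cmorph_lift|exact: ginzburg_lift_degrees|].
case=> [[b|b]|i]; rewrite ginzburg_lift_arr /=.
- by rewrite gdiff_gincl gdiff_arr mulr0 mul0r (lin_0 Ll).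
- rewrite (lin_Z (gdiff_linear rho)) (@transfer_gdiff K V Q Q' Q f g _ gP rho rho b) => [|a].
    have [rhob _] := hrho'; rewrite (gdiff_dual (rhob b)) ginzburg_lift_gincl -frho.
    by rewrite (lin_Z (cm_linear gP)) (lin_Z (@gincl_linear _ _ _)).
  by rewrite fK gdiff_dual //; case: hrho => ->.
rewrite (lin_Z (gdiff_linear rho)) !gdiff_loop !(cm_mul cmorph_lift).
rewrite !(cm_idem cmorph_lift) ginzburg_lift_commutators.
by rewrite -scale_mulr -scale_mull.
Qed.

End Lift.

(** The images of the dual arrows solve the equation of [commutators_eq] of which
    the dual arrows themselves are the solution. *)
Lemma fixes_duals (K : comPzRingType) (V : finType) (Q : quiver V)
    (F : pathalg K (ginzburg_quiver Q) -> pathalg K (ginzburg_quiver Q)) :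
  cmorph F -> degree_preserving F ->
  (forall b, F (arr K (garr b)) = arr K (garr b)) ->
  F (gsum_commutators K Q) = gsum_commutators K Q ->
  forall b, F (arr K (gdual b)) = arr K (gdual b).
Proof.
move=> FP Fdeg Farr Fsum; apply: commutators_eq => [b|b|b|b|].
- exact/Fdeg/(@degrees_in_arr K V Q (gdual b)).
- exact: (cm_arr (gdual b) FP).
- exact: (@degrees_in_arr K V Q (gdual b)).
- exact: gdual_idem.
rewrite -[RHS]Fsum /gsum_commutators (lin_sum (cm_linear FP)).
by apply: eq_bigr => b _; rewrite (lin_B (cm_linear FP)) !(cm_mul FP) Farr.
Qed.

Lemma ginzburg_liftK (K : comPzRingType) (V : finType) (Q Q' : quiver V)
    (f : pathalg K Q -> pathalg K Q') (g : pathalg K Q' -> pathalg K Q)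
    (c c' : K) :
  cmorph f -> cmorph g -> cancel f g -> cancel g f -> c * c' = 1 ->
  cancel (ginzburg_lift f g c) (ginzburg_lift g f c').
Proof.
move=> fP gP fK gK cc'.
have LP := cmorph_lift f c gP; have LP' := cmorph_lift g c' fP.
have CP := cmorph_comp LP LP'.
apply: (cmorph_eq CP (@cmorph_id K V _)) => -[[b|b]|i].
- by rewrite -[inl _]/(garr b) -gincl_arr !ginzburg_lift_gincl // gK.
- apply: (fixes_duals CP) => [D x xD|a|].
  + by apply: ginzburg_lift_degrees => //; apply: ginzburg_lift_degrees.
  + by rewrite -gincl_arr !ginzburg_lift_gincl // gK.
  rewrite (ginzburg_lift_commutators c gP fK) (lin_Z (cm_linear LP')).
  by rewrite (ginzburg_lift_commutators c' fP gK) scalerA cc' scale1r.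
rewrite ginzburg_lift_arr // (lin_Z (cm_linear LP')) ginzburg_lift_arr // scalerA cc'.
by rewrite scale1r.
Qed.

(** * Passing to the subring of elements of bounded degrees *)

Lemma cmorph_rmorphism (K : comPzRingType) (V : finType) (Q Q' : quiver V)
    (f : pathalg K Q -> pathalg K Q') : cmorph f ->
  exists F : {rmorphism pathalg K Q -> pathalg K Q'}, forall x, F x = f x.
Proof.
move=> fP.
have fB : Algebra.zmod_morphism f by move=> x y; rewrite (lin_B (cm_linear fP)).
have fM : GRing.monoid_morphism f by split; [exact: cm_1|exact: cm_mul].
pose aM := GRing.isZmodMorphism.Build _ _ f fB.
pose mM := GRing.isMonoidMorphism.Build _ _ f fM.
by exists (HB.pack f aM mM : {rmorphism pathalg K Q -> pathalg K Q'}).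
Qed.

Section Restriction.
Variables (K : comPzRingType) (V : finType) (Q Q' : quiver V).
Local Notation Qt := (ginzburg_quiver Q).
Local Notation Qt' := (ginzburg_quiver Q').
Variables (F : pathalg K Qt -> pathalg K Qt').
Hypotheses (FP : cmorph F) (Fdeg : degree_preserving F).

Lemma bounded_image (x : ginzburg K Q) : F (gval x) \in bounded_degrees K V Q'.
Proof.
have /boundedP[N xN] := gvalP x.
by apply/boundedP; exists N; apply: Fdeg.
Qed.

Definition restriction (x : ginzburg K Q) : ginzburg K Q' :=
  Ginzburg (bounded_image x).

Lemma restriction_zmod : Algebra.zmod_morphism restriction.
Proof. by move=> x y; apply: val_inj; rewrite /= (lin_B (cm_linear FP)). Qed.

Lemma restriction_monoid : GRing.monoid_morphism restriction.
Proof.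
split; first by apply: val_inj; rewrite /= cm_1.
by move=> x y; apply: val_inj; rewrite /= (cm_mul FP).
Qed.

Definition restriction_rmorphism : {rmorphism ginzburg K Q -> ginzburg K Q'} :=
  HB.pack restriction
    (GRing.isZmodMorphism.Build _ _ restriction restriction_zmod)
    (GRing.isMonoidMorphism.Build _ _ restriction restriction_monoid).

Lemma restriction_continuous : continuous restriction.
Proof.
apply: (@continuous_comp_initial (ginzburg K Q') _ _ (@gval K V Q')).
move=> x; apply: (@continuous_comp _ _ _ (@gval K V Q) F).
  exact: initial_continuous.
exact: filtered_continuous (cm_linear FP) (cm_filtered FP) _.
Qed.

End Restriction.

Section Main.
Variables (K : comPzRingType) (V : finType) (Q Q' : quiver V).
Variables (rho : arrow Q -> pathalg K Q) (rho' : arrow Q' -> pathalg K Q').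
Hypotheses (hrho : hyperpotential rho) (hrho' : hyperpotential rho').

Lemma pushforward_scale (f : pathalg K Q -> pathalg K Q') c b : linear f ->
  pushforward f (fun a => c *: rho a) b = c *: pushforward f rho b.
Proof.
move=> fl; rewrite /pushforward scaler_sumr; apply: eq_bigr => a _.
rewrite (lin_Z fl); apply: pathalgP => p; rewrite coefZ /= psumZl.
apply: eq_psum => u v; rewrite psumZl; apply: eq_psum => w w'.
by rewrite mulrCA.
Qed.

(** Compatibility with the differentials is verified for the lift [Psi] of the
    inverse of the given isomorphism, where it follows directly from the formula
    for the pushforward, and is inherited by the inverse [Phi] of [Psi]. *)
Lemma right_equivalent_dg (c c' : K) : c * c' = 1 ->
  right_equivalent (fun a => c *: rho a) rho' ->
  exists Phi : {rmorphism ginzburg K Q -> ginzburg K Q'},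
    [/\ continuous_dg_isomorphism rho rho' Phi,
        (forall i, Phi (gidem K Q i) = gidem K Q' i)
      & (forall i, Phi (tloop K Q i) = c' *: tloop K Q' i)].
Proof.
move=> cc' [f [fZ [g fK gK] fc fi frho]].
have fP : cmorph f.
  have fl : linear f by move=> k x y; rewrite rmorphD fZ.
  by split=> //; [exact: rmorphM|exact: continuous_filtered].
have gP := cmorph_inv fP fK gK.
have c'c : c' * c = 1 by rewrite mulrC.
pose Psi := ginzburg_lift f g c; pose Phi := ginzburg_lift g f c'.
have PsiP : cmorph Psi := cmorph_lift f c gP.
have PhiP : cmorph Phi := cmorph_lift g c' fP.
have PhiK : cancel Phi Psi := ginzburg_liftK gP fP gK fK c'c.
have PsiK : cancel Psi Phi := ginzburg_liftK fP gP fK gK cc'.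
have Phideg : degree_preserving Phi := @ginzburg_lift_degrees _ _ _ _ g f c' fP.
have Psideg : degree_preserving Psi := @ginzburg_lift_degrees _ _ _ _ f g c gP.
have Psid x : gdiff rho (Psi x) = Psi (gdiff rho' x).
  apply: ginzburg_lift_gdiff => // b.
  by rewrite -frho (pushforward_scale _ _ (cm_linear fP)).
exists (restriction_rmorphism PhiP Phideg); split; first split.
- by move=> k x; apply: val_inj; rewrite /= (lin_Z (cm_linear PhiP)).
- exists (restriction Psideg) => x; apply: val_inj; rewrite /=.
    exact: PhiK.
  exact: PsiK.
- by move=> n x; apply: Phideg.
- by move=> x; apply: val_inj; rewrite /= -{1}(PhiK (gval x)) Psid PsiK.
- by move=> n; apply: continuous_subspaceT; apply: restriction_continuous.
- by move=> i; apply: val_inj; apply: (cm_idem PhiP).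
by move=> i; apply: val_inj; rewrite /= -/(arr K (gloop Q i)) /Phi ginzburg_lift_arr.
Qed.

End Main.

(** * From an isomorphism of Ginzburg algebras to one of path algebras *)

Section DegreeZeroPart.
Variables (K : comPzRingType) (V : finType) (Q : quiver V).
Local Notation Qt := (ginzburg_quiver Q).

Lemma pdeg_le0 (p : qpath Qt) : pdeg p <= 0.
Proof.
rewrite /pdeg; elim/big_rec: _ => // -[[a|a]|i] m _ m0;
  by rewrite /= ?add0r // ler_wnDl.
Qed.

Lemma component_bounded n (x : ginzburg K Q) :
  (PathAlg (fun p => if pdeg p == n then gval x p else 0) : pathalg K Qt)
    \in bounded_degrees K V Q.
Proof.
by apply: (degrees_in1_bounded (n := n)) => p /= /eqP/negbTE->.
Qed.

Definition component n x : ginzburg K Q := Ginzburg (component_bounded n x).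

Lemma component_homogeneous n x : homogeneous n (component n x).
Proof. by move=> p /= /eqP/negbTE->. Qed.

Lemma gval_sum (I : Type) (r : seq I) (P : pred I) (F : I -> ginzburg K Q) :
  gval (\sum_(i <- r | P i) F i) = \sum_(i <- r | P i) gval (F i).
Proof. exact: (big_morph (@gval K V Q)). Qed.

(** The sum is finite because degrees are bounded from below, and nonpositive. *)
Lemma sum_components (x : ginzburg K Q) :
  exists N, x = \sum_(k < N) component (- k%:Z) x.
Proof.
have /boundedP[M xM] := gvalP x; exists (`|M|%N).+1; apply: val_inj.
rewrite /= gval_sum; apply: pathalgP => p; rewrite coef_sum.
have pdE : pdeg p = - (`|pdeg p|%N)%:Z.
  by rewrite abszE ler0_norm ?opprK ?pdeg_le0.
have [Mp|pM] := leqP `|pdeg p|%N `|M|%N.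
  rewrite (bigD1 (Ordinal (Mp : (`|pdeg p|%N < `|M|%N.+1)%N))) //= -pdE eqxx.
  rewrite big1 ?addr0 // => k kp; case: ifP => // /eqP pk.
  by case/eqP: kp; apply: val_inj; rewrite /= pk abszN absz_nat.
rewrite [RHS]big1 => [|k _ /=]; last first.
  case: ifP => // /eqP pk; move: pM; rewrite pk abszN absz_nat.
  by rewrite ltnNge -ltnS ltn_ord.
apply: xM => /= Mp; move: pM; rewrite ltnNge => /negP; apply.
have M0 : M <= 0 by apply: le_trans (pdeg_le0 p).
by rewrite -lez_nat !abszE !ler0_norm ?pdeg_le0 // lerN2.
Qed.

End DegreeZeroPart.

Section Converse.
Variables (K : comPzRingType) (V : finType) (Q Q' : quiver V).
Variable Phi : {rmorphism ginzburg K Q -> ginzburg K Q'}.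
Hypotheses (PhiZ : scalable Phi)
  (Phi_deg : forall n x, homogeneous n x -> homogeneous n (Phi x))
  (Phi_cont : {within homogeneous 0, continuous Phi})
  (Phi_idem : forall i, Phi (gidem K Q i) = gidem K Q' i).

Definition degree0_part (x : pathalg K Q) : pathalg K Q' :=
  gproj (gval (Phi (ginclelt x))).

Lemma gincl_degree0_part x :
  gincl (degree0_part x) = gval (Phi (ginclelt x)).
Proof. by apply: ginclK; apply: Phi_deg; apply: degrees_in_gincl. Qed.

Lemma degree0_part_filtered : filtered degree0_part.
Proof.
move=> n.
have h0 : homogeneous 0 (0 : ginzburg K Q) by [].
have /subspace_continuousP/(_ _ h0) := Phi_cont.
move=> Phi0.
pose B : set (pathalg K (ginzburg_quiver Q')) := [set y | vanishes n y].
have B0 : nbhs (0 : ginzburg K Q') (@gval K V Q' @^-1` B).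
  apply: (@initial_continuous _ _ (@gval K V Q')).
  by exists n => // y yn p pn; rewrite yn.
rewrite -(rmorph0 Phi) in B0.
have := Phi0 _ B0.
rewrite /= => -[_ [[C Cop <-] C0 CB]].
have [N _ NC] := Cop _ C0.
exists N => x xN; have /= := CB (ginclelt x).
move=> h p pn; apply: (h _ (@degrees_in_gincl _ _ _ x)) => [|].
  by apply: NC => q qN; apply: vanishes_gincl xN _ qN.
by rewrite plen_gpath.
Qed.

Lemma ginclelt_linear : linear (@ginclelt K V Q).
Proof. by move=> k x y; apply: val_inj; rewrite /= gincl_linear. Qed.

Lemma gval_Phi_linear : linear (fun x => gval (Phi x)).
Proof. by move=> k x y; rewrite /= rmorphD PhiZ. Qed.

Lemma cmorph_degree0_part : cmorph degree0_part.
Proof.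
split.
- apply: linear_comp (@gproj_linear K V Q').
  exact: linear_comp ginclelt_linear gval_Phi_linear.
- move=> x y; rewrite /degree0_part -gprojM -[_ * gval _]/(gval (_ * _)).
  rewrite -rmorphM; congr (gproj (gval (Phi _))); apply: val_inj.
  exact: ginclM.
- exact: degree0_part_filtered.
move=> i; rewrite /degree0_part.
have -> : ginclelt (idem K Q i) = gidem K Q i.
  by apply: val_inj; apply: gincl_idem.
by rewrite Phi_idem /= -/(idem K _ i) -gincl_idem gprojK.
Qed.

Hypothesis Phi_bij : bijective Phi.

(** The preimage of an element of degree zero has degree zero, because its other
    components have images of other degrees, whose sum has degree zero. *)
Lemma degree0_part_bijective : bijective degree0_part.
Proof.
have [Psi PhiK PsiK] := Phi_bij.
have Psi_deg y : homogeneous 0 y -> homogeneous 0 (Psi y).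
  move=> y0; have [N xE] := sum_components (Psi y).
  have yE : y = \sum_(k < N) Phi (component (- k%:Z) (Psi y)).
    by rewrite -{1}(PsiK y) {1}xE rmorph_sum.
  suff c0 (k : 'I_N) : k != 0%N :> nat -> component (- k%:Z) (Psi y) = 0.
    rewrite xE => p p0; rewrite gval_sum coef_sum big1 // => k _.
    have [k0|/c0->//] := eqVneq (k : nat) 0%N.
    by apply: component_homogeneous; rewrite k0 oppr0.
  move=> k0; apply: (can_inj PhiK); rewrite rmorph0.
  have Pdeg (j : 'I_N) : homogeneous (- j%:Z) (Phi (component (- j%:Z) (Psi y))).
    by apply: Phi_deg; apply: component_homogeneous.
  apply: val_inj; apply: pathalgP => p.
  have [pk|/eqP pk] := eqVneq (pdeg p) (- k%:Z); last exact: Pdeg.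
  have /= : gval y p = 0.
    apply: y0 => /= p0; move: pk; rewrite p0 => /eqP.
    by rewrite eq_sym oppr_eq0 eqz_nat (negbTE k0).
  rewrite {1}yE gval_sum coef_sum (bigD1 k) //= big1 ?addr0 // => j jk.
  apply: Pdeg; rewrite /= pk => /oppr_inj [kj].
  by case/eqP: jk; apply: val_inj.
exists (fun y => gproj (gval (Psi (ginclelt y)))) => x.
  apply: (can_inj (@gprojK K V Q)).
  rewrite ginclK; last by apply: Psi_deg; apply: degrees_in_gincl.
  rewrite -[RHS]/(gval (ginclelt x)) -[in RHS](PhiK (ginclelt x)).
  congr (gval (Psi _)); apply: val_inj; exact: gincl_degree0_part.
apply: (can_inj (@gprojK K V Q')).
rewrite gincl_degree0_part -[RHS]/(gval (ginclelt x)) -[in RHS](PsiK (ginclelt x)).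
congr (gval (Phi _)); apply: val_inj; apply: ginclK.
by apply: Psi_deg; apply: degrees_in_gincl.
Qed.

Variables (rho : arrow Q -> pathalg K Q) (rho' : arrow Q' -> pathalg K Q').
Hypotheses (hrho : hyperpotential rho) (hrho' : hyperpotential rho').
Hypothesis Phi_d : forall x, Phi (dginzburg rho x) = dginzburg rho' (Phi x).
Variable c : K.
Hypothesis Phi_loop : forall i, Phi (tloop K Q i) = c *: tloop K Q' i.

(** Applying [Phi] to the differentials of the loops gives
    [sum_a [f a, Phi a*] = c sum_b [b, b*]], where [f] is [degree0_part]. The
    left-hand side is [sum_b [b, z b]], so [z b = c b*] by injectivity, and the
    claim is the differential of this equality. *)
Lemma degree0_part_pushforward b :
  pushforward degree0_part rho b = c *: rho' b.
Proof.
pose m a := gval (Phi (gdualelt K a)).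
have m_deg a : degrees_in [set -1] (m a).
  exact/Phi_deg/(@degrees_in_arr K V Q (gdual a)).
have fP := cmorph_degree0_part.
pose z := transfer degree0_part id m.
have zE : forall b, z b = c *: arr K (gdual b).
  apply: commutators_eq => [a|a|a|a|].
  - exact: transfer_deg (@cmorph_id K V Q') m_deg a.
  - exact: transfer_idem (@cmorph_id K V Q') a.
  - by apply: degrees_inZ; apply: (@degrees_in_arr K V Q' (gdual a)).
  - by rewrite -scale_mulr -scale_mull gdual_idem.
  under eq_bigr => a _ do rewrite -!gincl_arr.
  rewrite (transfer_commutators _ _ (@cmorph_id K V Q')).
  transitivity (c *: gsum_commutators K Q'); last first.
    rewrite /gsum_commutators scaler_sumr; apply: eq_bigr => a _.
    by rewrite -scale_mulr -scale_mull scalerBr.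
  rewrite -gsum_diag scaler_sumr; apply: eq_bigr => i _.
  rewrite -(gdiff_loop rho' i) -(lin_Z (gdiff_linear rho')).
  have := congr1 (@gval K V Q') (Phi_d (tloop K Q i)).
  rewrite Phi_loop /= -/(arr K (gloop Q' i)) => <-.
  rewrite dginzburg_loop !rmorphM !Phi_idem /=; congr (_ * _ * _).
  rewrite rmorph_sum gval_sum; apply: eq_bigr => a _.
  rewrite rmorphB !rmorphM /= !gincl_degree0_part.
  have -> : ginclelt (arr K a) = garrelt K a by apply: val_inj; apply: gincl_arr.
  by [].
apply: (can_inj (@gprojK K V Q')).
rewrite -[pushforward _ _ _]/(id (pushforward degree0_part rho b)).
rewrite -(transfer_gdiff (m := m) (@cmorph_id K V Q') (rho := rho')) => [|a].
  rewrite -/(z b) zE (lin_Z (gdiff_linear rho')) gdiff_dual.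
    by rewrite (lin_Z (@gincl_linear _ _ _)).
  by case: hrho' => ->.
rewrite gincl_degree0_part -(dginzburg_dual a hrho).
by rewrite -[LHS]/(gval (dginzburg rho' _)) -Phi_d.
Qed.

End Converse.

Lemma dg_right_equivalent (K : comPzRingType) (V : finType) (Q Q' : quiver V)
    (rho : arrow Q -> pathalg K Q) (rho' : arrow Q' -> pathalg K Q') (c c' : K)
    (Phi : {rmorphism ginzburg K Q -> ginzburg K Q'}) :
  hyperpotential rho -> hyperpotential rho' ->
  continuous_dg_isomorphism rho rho' Phi ->
  (forall i, Phi (gidem K Q i) = gidem K Q' i) ->
  (forall i, Phi (tloop K Q i) = c *: tloop K Q' i) ->
  c' * c = 1 -> right_equivalent (fun a => c' *: rho a) rho'.
Proof.
move=> hrho hrho' [PZ Pbij Pdeg Pd Pc] Pe Pt c'c.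
have fP := cmorph_degree0_part PZ (Pc 0) Pe.
have [F FE] := cmorph_rmorphism fP.
have FfE : F = degree0_part Phi :> (_ -> _) by apply/funext.
exists F; rewrite FfE; split.
- exact: lin_Z (cm_linear fP).
- exact: degree0_part_bijective.
- exact: filtered_continuous (cm_linear fP) (cm_filtered fP).
- exact: cm_idem fP.
move=> b; rewrite (pushforward_scale _ _ _ (cm_linear fP)).
rewrite (degree0_part_pushforward PZ Pdeg (Pc 0) Pe hrho hrho' Pd Pt).
by rewrite scalerA c'c scale1r.
Qed.

Theorem proposition2p7 (K : comPzRingType) (V : finType) (Q Q' : quiver V)
    (rho : arrow Q -> pathalg K Q) (rho' : arrow Q' -> pathalg K Q')
    (hrho : hyperpotential rho) (hrho' : hyperpotential rho') :
  (right_equivalent rho rho' <->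
     exists Phi : {rmorphism ginzburg K Q -> ginzburg K Q'},
       [/\ continuous_dg_isomorphism rho rho' Phi,
           (forall i, Phi (gidem K Q i) = gidem K Q' i)
         & (forall i, Phi (tloop K Q i) = tloop K Q' i)])
  /\
  (weakly_right_equivalent rho rho' <->
     exists (Phi : {rmorphism ginzburg K Q -> ginzburg K Q'}) (c : K),
       [/\ continuous_dg_isomorphism rho rho' Phi,
           invertible c,
           (forall i, Phi (gidem K Q i) = gidem K Q' i)
         & (forall i, Phi (tloop K Q i) = c *: tloop K Q' i)]).
Proof.
have rho1 : (fun a => 1 *: rho a) = rho by apply/funext => a; rewrite scale1r.
split; split.
- rewrite -{1}rho1 => /(right_equivalent_dg hrho hrho' (mulr1 1)).
  by case=> Phi [dPhi ePhi tPhi]; exists Phi; split=> // i; rewrite tPhi scale1r.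
- case=> Phi [dPhi ePhi tPhi]; rewrite -rho1.
  apply: (dg_right_equivalent (c := 1) hrho hrho' dPhi ePhi); last exact: mulr1.
  by move=> i; rewrite tPhi scale1r.
- case=> c [c' cc'] /(right_equivalent_dg hrho hrho' cc')[Phi [dPhi ePhi tPhi]].
  by exists Phi, c'; split=> //; exists c; rewrite mulrC.
case=> Phi [c [dPhi [c' cc'] ePhi tPhi]]; exists c'.
  by exists c; rewrite mulrC.
by apply: (dg_right_equivalent hrho hrho' dPhi ePhi tPhi); rewrite mulrC.
Qed.
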